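(* For every $d\ge2$ and $H\le\Sigma_d$, the commutator subgroup $[V_d'(H),V_d'(H)]$ is simple.
   Context: $A=\{a_1,\dots,a_d\}$, $A^\omega$ the infinite words with ultrametric $d(x,y)=e^{1-n}$ ($n$ the first index where $x,y$ differ); balls are the sets $wA^\omega$, $w$ a finite word. $\Sigma_d$ is the symmetric group on $A$ acting letterwise on $A^\omega$, $A_d$ its alternating subgroup. $V_d(H)$ is the group of homeomorphisms $g$ of $A^\omega$ such that every point lies in a ball $w_1A^\omega$ on which $g$ has the form $w_1y\mapsto w_2\sigma(y)$ for some finite word $w_2$ and $\sigma\in H$. Every $g\in V_d(H)$ admits a *table*: finite words $v_1<\dots<v_m$ and $u_1<\dots<u_m$ (lexicographic order) such that $\{v_iA^\omega\}$ and $\{u_iA^\omega\}$ are partitions of $A^\omega$, elements $h_i\in H$ and $\tau\in\Sigma_m$ with $g(v_iy)=u_{\tau(i)}h_i(y)$; the table is *even/odd* according to the parity of $\tau$. If $d$ is odd and $H\le A_d$, the parity does not depend on the table and $V_d'(H)$ is the index-2 subgroup of elements with even tables; otherwise $V_d'(H)=V_d(H)$. *)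

(* Defs.v *)
From HB Require Import structures.
From mathcomp Require Import all_boot all_order all_fingroup.
Set Implicit Arguments. Unset Strict Implicit. Unset Printing Implicit Defensive.

(* Alphabet A = {a_1,...,a_d} is 'I_d (a_i <-> i-1, ordered by index).
   Infinite words A^omega are functions nat -> 'I_d; finite words are seq 'I_d. *)
Definition point (d : nat) := nat -> 'I_d.

Fixpoint cat_pt d (w : seq 'I_d) (y : point d) : point d :=
  match w with
  | [::] => y
  | a :: w' => fun n => match n with 0 => a | n'.+1 => cat_pt w' y n' end
  end.

Fixpoint in_ball d (w : seq 'I_d) (x : point d) : Prop :=
  match w with
  | [::] => True
  | a :: w' => x 0 = a /\ in_ball w' (fun n => x n.+1)
  end.

Definition act d (s : {perm 'I_d}) (y : point d) : point d := fun n => s (y n).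

(* x and y agree on the first n letters, i.e. dist(x,y) <= e^{-n} *)
Definition agree d (n : nat) (x y : point d) : Prop :=
  forall k, k < n -> x k = y k.

(* continuity for the ultrametric d(x,y) = e^{1-n} *)
Definition continuous_pt d (f : point d -> point d) : Prop :=
  forall x n, exists m, forall y, agree m x y -> agree n (f x) (f y).

Definition homeo d (g : point d -> point d) : Prop :=
  exists gi, cancel g gi /\ cancel gi g /\ continuous_pt g /\ continuous_pt gi.

Definition inV d (H : {set {perm 'I_d}}) (g : point d -> point d) : Prop :=
  homeo g /\
  forall x : point d, exists (w1 w2 : seq 'I_d) (s : {perm 'I_d}),
    s \in H /\ in_ball w1 x /\ forall y, g (cat_pt w1 y) = cat_pt w2 (act s y).

Fixpoint lex_lt d (s t : seq 'I_d) : bool :=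
  match s, t with
  | [::], [::] => false
  | [::], _ :: _ => true
  | _ :: _, [::] => false
  | a :: s', b :: t' => (a < b)%N || ((a == b) && lex_lt s' t')
  end.

Definition ball_partition d m (w : 'I_m -> seq 'I_d) : Prop :=
  (forall x : point d, exists i, in_ball (w i) x) /\
  (forall (i j : 'I_m) (x : point d), in_ball (w i) x -> in_ball (w j) x -> i = j).

Definition is_table d (H : {set {perm 'I_d}}) (g : point d -> point d) (m : nat)
  (v u : 'I_m -> seq 'I_d) (h : 'I_m -> {perm 'I_d}) (tau : {perm 'I_m}) : Prop :=
  (forall i j : 'I_m, (i < j)%N -> lex_lt (v i) (v j)) /\
  (forall i j : 'I_m, (i < j)%N -> lex_lt (u i) (u j)) /\
  ball_partition v /\ ball_partition u /\
  (forall i, h i \in H) /\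
  (forall i y, g (cat_pt (v i) y) = cat_pt (u (tau i)) (act (h i) y)).

Definition has_even_table d (H : {set {perm 'I_d}}) (g : point d -> point d) : Prop :=
  exists m v u h (tau : {perm 'I_m}), is_table H g v u h tau /\ ~~ odd_perm tau.

Definition inVprime d (H : {set {perm 'I_d}}) (g : point d -> point d) : Prop :=
  inV H g /\ ((odd d /\ (forall s, s \in H -> ~~ odd_perm s)) -> has_even_table H g).

(* Groups of bijections of a type T, given as predicates on T -> T. *)
Section Grp.
Variable T : Type.

Inductive comm_subgroup (G : (T -> T) -> Prop) : (T -> T) -> Prop :=
| cs_one : comm_subgroup G (fun x => x)
| cs_mul (g h gi hi k : T -> T) :
    G g -> G h -> cancel g gi -> cancel gi g -> cancel h hi -> cancel hi h ->
    comm_subgroup G k -> comm_subgroup G (gi \o hi \o g \o h \o k).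

Definition is_subgroup (N K : (T -> T) -> Prop) : Prop :=
  (forall n, N n -> K n) /\ N (fun x => x) /\
  (forall a b, N a -> N b -> N (a \o b)) /\
  (forall a ai, N a -> cancel a ai -> cancel ai a -> N ai).

Definition is_normal (N K : (T -> T) -> Prop) : Prop :=
  is_subgroup N K /\
  forall k ki n, K k -> cancel k ki -> cancel ki k -> N n -> N (ki \o n \o k).

Definition simple_grp (K : (T -> T) -> Prop) : Prop :=
  (exists k, K k /\ exists x, k x <> x) /\
  forall N, is_normal N K ->
    (forall n, N n -> forall x, n x = x) \/ (forall k, K k -> N k).
End Grp.

(* Main.v *)
(* The commutator subgroup K of G = V'_d(H) is simple by Higman's argument.  Call
   two elements of G co-small if they fix a common ball, and let M be generated by
   the commutators of co-small elements.
   K is contained in M: G is generated by elements fixing some ball, and such an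
   element is, modulo M, equal to a conjugate supported in a tiny ball, so any two of
   them commute modulo M.
   M is contained in every nontrivial normal subgroup N of K: if n in N moves a ball b
   off itself, f and g are supported in a small b0 in b, and t moves b0 around in b,
   then [[t,f]^-1 [t,f]^n, [g,t^-1]] lies in N and equals [f^-1,g^-1]; any co-small
   pair is conjugate in K to such a pair.
   The moves needed are products of 3-cycles of balls.  When d is odd and H consists
   of even permutations, table parity is the parity of the number of inversions of g
   on the words of any large length; it is additive under composition, hence vanishes
   on 3-cycles (which are squares), and it is realized by a table. *)
Require Import Defs.
From HB Require Import structures.
From mathcomp Require Import all_boot all_order all_fingroup.
From mathcomp Require Import boolp zify.
Set Implicit Arguments. Unset Strict Implicit. Unset Printing Implicit Defensive.
Local Open Scope group_scope.
Local Notation act := Defs.act.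

(** * The group of bijections of a type *)

Record bij (T : Type) := Bij {
  bfun :> T -> T;
  binv : T -> T;
  bfunK : cancel bfun binv;
  binvK : cancel binv bfun }.

Section BijGroup.
Variable T : Type.
Implicit Types f g : bij T.

(** The function determines its two-sided inverse, and the cancellation proofs are equal by proof
    irrelevance. *)
Lemma bij_ext f g : bfun f =1 bfun g -> f = g.
Proof.
case: f g => [f fi fK fiK] [g gi gK giK] /= /funext efg.
have egi : fi = gi by apply: funext => x; apply: (can_inj fK); rewrite fiK efg giK.
by move: fK fiK gK giK; rewrite efg egi => *; congr Bij; exact: Prop_irrelevance.
Qed.

Definition bij_one : bij T := @Bij T id id (fun=> erefl) (fun=> erefl).
Definition bij_inv f : bij T := Bij (@binvK _ f) (@bfunK _ f).
Definition bij_mul f g : bij T :=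
  Bij (can_comp (@bfunK _ f) (@bfunK _ g)) (can_comp (@binvK _ g) (@binvK _ f)).

HB.instance Definition _ := gen_eqMixin (bij T).
HB.instance Definition _ := gen_choiceMixin (bij T).

Lemma bij_mulA : associative bij_mul.
Proof. by move=> f g h; apply: bij_ext. Qed.
Lemma bij_mul1 : left_id bij_one bij_mul.
Proof. by move=> f; apply: bij_ext. Qed.
Lemma bij_mulr1 : right_id bij_one bij_mul.
Proof. by move=> f; apply: bij_ext. Qed.
Lemma bij_mulV : left_inverse bij_one bij_inv bij_mul.
Proof. by move=> f; apply: bij_ext => x /=; rewrite bfunK. Qed.
Lemma bij_mulrV : right_inverse bij_one bij_inv bij_mul.
Proof. by move=> f; apply: bij_ext => x /=; rewrite binvK. Qed.

HB.instance Definition _ := @isGroup.Build (bij T) bij_one bij_inv bij_mul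
  bij_mulA bij_mul1 bij_mulr1 bij_mulV bij_mulrV.

Lemma bijM f g x : (f * g) x = f (g x). Proof. by []. Qed.
Lemma bijK f : cancel f f^-1. Proof. exact: bfunK. Qed.
Lemma bijVK f : cancel f^-1 f. Proof. exact: binvK. Qed.
Lemma bijJ f g x : (f ^ g) x = g^-1 (f (g x)). Proof. by []. Qed.
Lemma bij_inj f : injective f. Proof. exact: can_inj (bijK f). Qed.

End BijGroup.

(** * Subgroups generated by commutators *)

Section CommGen.
Variable gT : groupType.
Implicit Types (R : gT -> gT -> Prop) (P : gT -> Prop).

(** Products suffice when [R] is symmetric, since the inverse of [[~ g, h]] is [[~ h, g]]. The shape
    matches that of [comm_subgroup]. *)
Inductive commgen R : gT -> Prop :=
| commgen1 : commgen R 1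
| commgenM g h k : R g h -> commgen R k -> commgen R ([~ g, h] * k).

Definition subgrp P :=
  [/\ P 1, forall a b, P a -> P b -> P (a * b) & forall a, P a -> P a^-1].

Lemma commgen_gen R g h : R g h -> commgen R [~ g, h].
Proof. by move=> Rgh; rewrite -[[~ g, h]]mulg1; apply: commgenM => //; apply: commgen1. Qed.

Lemma commgen_sub R P : subgrp P -> (forall g h, R g h -> P [~ g, h]) ->
  forall k, commgen R k -> P k.
Proof. by case=> P1 PM _ PR k; elim=> // g h {}k Rgh _ Pk; apply/PM => //; apply: PR. Qed.

Lemma commgen_mul R a b : commgen R a -> commgen R b -> commgen R (a * b).
Proof.
by move=> + Rb; elim=> [|g h k Rgh _ IH]; rewrite ?mul1g // -mulgA; apply: commgenM.
Qed.

Lemma commgen_subgrp R : (forall g h, R g h -> R h g) -> subgrp (commgen R).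
Proof.
move=> Rsym; split; [exact: commgen1 | exact: commgen_mul | move=> a].
elim=> [|g h k Rgh _ IH]; first by rewrite invg1; apply: commgen1.
by rewrite invMg invg_comm; apply: commgen_mul IH (commgen_gen (Rsym _ _ Rgh)).
Qed.

Lemma commgen_conj R x a : (forall g h, R g h -> R (g ^ x) (h ^ x)) ->
  commgen R a -> commgen R (a ^ x).
Proof.
move=> RJ; elim=> [|g h k Rgh _ IH]; first by rewrite conj1g; apply: commgen1.
by rewrite conjMg conjRg; apply: commgenM => //; apply: RJ.
Qed.

Lemma commMg_conj (x y z : gT) : [~ x * y, z] = [~ x, z] ^ y * [~ y, z].
Proof. by rewrite !commgEr conjgM mulgA -conjMg mulgK. Qed.

Lemma commgM_conj (x y z : gT) : [~ x, y * z] = [~ x, z] * [~ x, y] ^ z.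
Proof. by rewrite !commgEl conjgM -mulgA -conjMg mulVKg. Qed.

(** In [[~ x, y] ^ x1 * [~ x1, y]] the conjugation is trivial and the second factor is 1. Repeated
    use of this evaluates the double commutator below. *)
Lemma commg_absorb (x x1 y : gT) :
  commute x x1 -> commute y x1 -> [~ x * x1, y] = [~ x, y].
Proof.
move=> cx cy; have fixx z : commute z x1 -> z ^ x1 = z by move/commgP/conjg_fixP.
rewrite commMg_conj conjRg !fixx //.
by move/commute_sym/commgP/eqP: cy => ->; rewrite mulg1.
Qed.

End CommGen.

(** * Higman's argument for an abstract group of bijections with a family of balls *)

Section Simplicity.
Variables (T W : Type) (inb : W -> T -> bool) (G : bij T -> Prop).
Implicit Types (f g s t n : bij T) (b c e : W).

Definition fixes f c := forall x, inb c x -> f x = x.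
Definition supp_in f c := forall x, ~~ inb c x -> f x = x.
Definition small f := G f /\ exists c, fixes f c.

Hypothesis G_grp : subgrp G.
Hypothesis ball_cont : forall g c, G g -> exists c', forall x, inb c' x -> inb c (g x).
Hypothesis small_gen : forall P : bij T -> Prop, subgrp P ->
  (forall f, small f -> P f) -> forall g, G g -> P g.
Hypothesis push_small : forall c e, exists t c1 e1,
  [/\ G t, forall x, inb c1 x -> inb c x, forall x, inb e1 x -> inb e x,
      fixes t c1 & forall x, inb e1 x -> inb c (t x)].
Hypothesis push : forall b c, exists2 t, G t & forall x, ~~ inb b x -> inb c (t x).
(** This makes [b0], its image and its preimage under [t] pairwise disjoint parts of [b]; the
    condition on [t (t x)] separates the image from the preimage. *)
Hypothesis rotate : forall b, exists t b0,
  [/\ G t, forall x, inb b0 x -> [/\ inb b x, inb b (t x) & inb b (t^-1 x)] &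
      forall x, inb b0 x -> [/\ ~~ inb b0 (t x), ~~ inb b0 (t^-1 x) & ~~ inb b0 (t (t x))]].
Hypothesis displace : forall g x, G g -> g x <> x ->
  exists b, forall y, inb b y -> ~~ inb b (g y).

Let K := commgen (fun f g => G f /\ G g).
Definition co_small f g := [/\ G f, G g & exists2 c, fixes f c & fixes g c].
Let M := commgen co_small.

Let G1 : G 1. Proof. by case: G_grp. Qed.
Let GM f g : G f -> G g -> G (f * g). Proof. by case: G_grp => _ + _; apply. Qed.
Let GV f : G f -> G f^-1. Proof. by case: G_grp => _ _; apply. Qed.
Let GJ f g : G f -> G g -> G (f ^ g).
Proof. by move=> Gf Gg; apply/GM/GM => //; apply: GV. Qed.
Let GR f g : G f -> G g -> G [~ f, g].
Proof. by move=> Gf Gg; apply: GM; [apply: GV | apply: GJ]. Qed.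

Let KG f : K f -> G f.
Proof. by apply: commgen_sub => // g h []; apply: GR. Qed.
Let K_grp : subgrp K. Proof. by apply: commgen_subgrp => f g []. Qed.
Let KJ f g : K f -> G g -> K (f ^ g).
Proof. by move=> Kf Gg; apply: commgen_conj Kf => x y [Gx Gy]; split; apply: GJ. Qed.

Let M_grp : subgrp M.
Proof. by apply: commgen_subgrp => f g [Gf Gg [c fc gc]]; split=> //; exists c. Qed.

Lemma fixesJ f g c c' :
  (forall x, inb c' x -> inb c (g x)) -> fixes f c -> fixes (f ^ g) c'.
Proof. by move=> cc' fc x xc'; rewrite bijJ fc ?bijK //; apply: cc'. Qed.

Let MJ f g : M f -> G g -> M (f ^ g).
Proof.
move=> Mf Gg; apply: commgen_conj Mf => x y [Gx Gy [c xc yc]].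
have [c' cc'] := ball_cont c Gg.
by split; [apply: GJ | apply: GJ | exists c'; apply: fixesJ cc' _].
Qed.

Let MJV f g : G g -> M (f ^ g) -> M f.
Proof. by move=> Gg Mf; rewrite -(conjgK g f); apply: MJ => //; apply: GV. Qed.

(** Since [t] fixes part of [c], [[~ f, t]] is in [M], so [f] and [f ^ t] agree modulo [M]. Since
    [t] carries part of [e] into [c], [f ^ t] is co-small with [g] and commutes with it modulo
    [M]. *)
Lemma small_comm f g : small f -> small g -> M [~ f, g].
Proof.
move=> [Gf [c fc]] [Gg [e ge]].
have [t [c1 [e1 [Gt c1c e1e tc1 te1]]]] := push_small c e.
have [_ MM MV] := M_grp.
have Mft : M [~ f, t].
  by apply: commgen_gen; split=> //; exists c1 => // x /c1c; apply: fc.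
have Mftg : M [~ f ^ t, g].
  apply: commgen_gen; split=> //; first exact: GJ.
  by exists e1 => [|x /e1e]; [apply: fixesJ fc | apply: ge].
have eq_ft : f ^ t = f * [~ f, t] by rewrite commgEl mulVKg.
apply: (@MJV _ [~ f, t]); first by apply: GR.
rewrite eq_ft commMg_conj in Mftg.
rewrite -[_ ^ _](mulgK [~ [~ f, t], g]); apply/MM => //.
by apply/MV; rewrite [X in M X]commgEl; apply/MM; [apply/MV | apply: MJ].
Qed.

(** The elements commuting with [f] modulo [M] form a subgroup of [G], and [G] is generated by its
    small elements. *)
Lemma centralize_mod_small f : (forall s, small s -> M [~ f, s]) ->
  forall g, G g -> M [~ f, g].
Proof.
move=> Mf g Gg.
(* Membership in [G] is carried along because [M] is stable under conjugation by elements of [G]. *)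
suff [] : G g /\ M [~ f, g] by [].
move: g Gg; apply: small_gen => [|s ss]; last by split; [case: ss | apply: Mf].
have [M1 MM MV] := M_grp.
split=> [|a b [Ga Ma] [Gb Mb]|a [Ga Ma]]; first by rewrite commg1.
  by split; [apply: GM | rewrite commgM_conj; apply/MM => //; apply: MJ].
split; first exact: GV.
apply: (@MJV _ a) => //; have := commgM_conj f a^-1 a.
rewrite mulVg commg1 => /esym /(canRL (mulKg _)) ->; rewrite mulg1.
exact: MV.
Qed.

Lemma comm_sub_co_small f : K f -> M f.
Proof.
apply: commgen_sub => // {}f g [Gf Gg].
have [M1 MM MV] := M_grp.
have symM x y : M [~ x, y] -> M [~ y, x] by rewrite -invgR; apply/MV.
apply: centralize_mod_small => // s ss; apply/symM.
by apply: centralize_mod_small => // s' ss'; apply: small_comm.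
Qed.

Lemma supp_comm (P : pred T) f g :
  (forall x, ~~ P x -> f x = x) -> (forall x, P x -> g x = x) -> commute f g.
Proof.
move=> fP gP; apply: bij_ext => x; rewrite !bijM; case: (boolP (P x)) => Px.
  (* [f] preserves [P]: if [f x] were outside, [f] would fix it, and injectivity would give
     [f x = x]. *)
  rewrite (gP x) // gP //; apply/negPn/negP => nP; have fx := bij_inj (fP _ nP).
  by rewrite fx Px in nP.
rewrite (fP x) // fP //; apply/negP => nP; have gx := bij_inj (gP _ nP).
by rewrite gx (negPf Px) in nP.
Qed.

Lemma supp_inV f c : supp_in f c -> supp_in f^-1 c.
Proof. by move=> sf x xc; rewrite -{1}(sf x xc) bijK. Qed.

Lemma supp_inJ f g b c :
  (forall x, ~~ inb b x -> inb c (g x)) -> fixes f c -> supp_in (f ^ g) b.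
Proof. by move=> bc fc x xb; rewrite bijJ fc ?bijK //; apply: bc. Qed.

(* Allows [f] to be replaced by an element of [K] acting the same way outside [c]. *)
Lemma correct_mod_comm c f : G f -> exists r, [/\ G r, supp_in r c & K (r * f)].
Proof.
have [K1 KM KV] := K_grp.
move: f; apply: small_gen => [|s [Gs [e se]]].
  split; first by exists 1; split=> //; rewrite mulg1.
    move=> x y [ra [Ga sa Ka]] [rb [Gb sb Kb]].
    exists (rb * ra); split; [exact: GM | by move=> z zc; rewrite bijM sa ?sb |].
    have -> : rb * ra * (x * y) = (ra * x) ^ rb^-1 * (rb * y).
      by rewrite conjgE invgK !mulgA mulgVK.
    by apply/KM => //; apply: KJ => //; apply: GV.
  move=> a [r [Gr sr Kr]]; exists r^-1; split; first exact: GV.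
    by move=> x xc; rewrite -{1}(sr x xc) bijK.
  have Ga : G a by rewrite -(mulKg r a); apply: GM; [exact: GV | exact: KG].
  have -> : r^-1 * a^-1 = (r * a)^-1 ^ r.
    by rewrite invMg conjgE !mulgA mulgVK.
  by apply: KJ => //; apply/KV.
(* For [s] fixing [e], the conjugate [s ^ t] is supported in [c], and [(s ^ t)^-1 * s] is the
   commutator [[~ t, s]]. *)
have [t Gt tce] := push c e.
exists (s ^ t)^-1; split; first by apply: GV; apply: GJ.
  by move=> x xc; rewrite -{1}(supp_inJ tce se xc) bijK.
by rewrite -conjVg -commgEr; apply: commgen_gen.
Qed.

(** * Nontrivial normal subgroups of the commutator subgroup *)

Section Normal.
Variable N : bij T -> Prop.
Hypothesis N_grp : subgrp N.
Hypothesis NK : forall f, N f -> K f.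
Hypothesis NJ : forall f g, N f -> K g -> N (f ^ g).

(** [[~ t, f]] and [[~ g, t^-1]] are supported in [b], which [n] moves off itself, so conjugating
    the first by [n] makes it act trivially on [b]. The remaining conjugates by [t] and [t^-1] live
    on parts of [b] disjoint from [b0] and from each other. *)
Lemma local_comm_in_normal n x : N n -> n x <> x ->
  exists b0, forall f g, G f -> G g -> supp_in f b0 -> supp_in g b0 -> N [~ f, g].
Proof.
move=> Nn nx; have Gn : G n by apply: KG; apply: NK.
have [b nb] := displace Gn nx; have [t [b0 [Gt b0b b0t]]] := rotate b.
have [N1 NM NV] := N_grp.
(* The double commutator produces inverses, so the claim is proved in that form and then applied to
   [f^-1] and [g^-1]. *)
suff NfV f g : G f -> G g -> supp_in f b0 -> supp_in g b0 -> N [~ f^-1, g^-1].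
  exists b0 => f g Gf Gg sf sg; rewrite -(invgK f) -(invgK g).
  by apply: NfV; rewrite ?GV //; try exact: GV; apply: supp_inV.
move=> Gf Gg sf sg.
have [sfV sgV] := (supp_inV sf, supp_inV sg).
have ft x' : ~~ inb b0 (t x') -> (f ^ t) x' = x'.
  by move=> tx; rewrite bijJ sf ?bijK.
have gt x' : ~~ inb b0 (t^-1 x') -> (g ^ t^-1) x' = x'.
  by move=> tx; rewrite bijJ invgK sg ?bijVK.
have supp_b h x' : supp_in h b0 -> ~~ inb b x' -> h x' = x'.
  by move=> sh xb; apply: sh; apply: contra xb => /b0b [].
have ft_supp : supp_in [~ f, t] b.
  move=> x' xb; rewrite commgEl bijM ft ?(supp_b f^-1) //.
  by apply: contra xb => /b0b [_ _]; rewrite bijK.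
have gt_supp : supp_in [~ g, t^-1] b.
  move=> x' xb; rewrite commgEl bijM gt ?(supp_b g^-1) //.
  by apply: contra xb => /b0b [_ + _]; rewrite bijVK.
have tf_n x' : inb b x' -> ([~ t, f] ^ n) x' = x'.
  move=> /nb nxb; rewrite bijJ -invgR (supp_inV ft_supp) ?bijK //.
have ft_fix x' : inb b0 x' -> (f ^ t) x' = x' by case/b0t => *; apply: ft.
have gt_fix x' : inb b0 x' -> (g ^ t^-1) x' = x' by case/b0t => *; apply: gt.
(* [[~ g, t^-1]] is [g^-1 * g ^ t^-1], supported in [b0] and its image under [t], whereas [f ^ t] is
   supported in the preimage of [b0]. *)
have cgf : commute [~ g, t^-1] (f ^ t).
  apply/commute_sym/commuteM; first exact/commute_sym/(supp_comm sgV ft_fix).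
  apply: (@supp_comm (fun x' => inb b0 (t x'))) => [x'|x' tx']; first exact: ft.
  by apply: gt; apply/negP => /b0t [_ _]; rewrite bijVK tx'.
(* Three factors are absorbed in turn: [[~ t, f] ^ n], then [f ^ t] from [[~ f, t]], then [g ^ t^-1]
   from [[~ g, t^-1]]. *)
have <- : [~ [~ t, f]^-1 * [~ t, f] ^ n, [~ g, t^-1]] = [~ f^-1, g^-1].
  rewrite commg_absorb ?invgR; first last.
  - exact: supp_comm gt_supp tf_n.
  - exact: supp_comm ft_supp tf_n.
  rewrite [X in [~ X, _]]commgEl commg_absorb //; last exact: supp_comm sfV ft_fix.
  rewrite -invgR [X in [~ X, _]]commgEl commg_absorb ?invgR //.
    exact: supp_comm sgV gt_fix.
  exact: supp_comm sfV gt_fix.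
have Ktf : K [~ t, f] by apply: commgen_gen.
have Kgt : K [~ g, t^-1] by apply: commgen_gen; split=> //; apply: GV.
(* This element is [[~ [~ t, f], n]], the product of a [K]-conjugate of [n^-1] and of [n]. *)
have Nm : N ([~ t, f]^-1 * [~ t, f] ^ n).
  by rewrite -commgEl commgEr; apply/NM => //; apply: NJ => //; apply/NV.
by rewrite commgEl; apply/NM; [apply/NV | apply: NJ].
Qed.

(** A conjugator sending the complement of [b0] into the commonly fixed ball [c] brings both
    supports into [b0]. As [N] is only known to be stable under [K], the conjugator is first
    corrected by an element supported in [c], which keeps [c] invariant. *)
Lemma co_small_in_normal n x : N n -> n x <> x -> forall f, M f -> N f.
Proof.
move=> Nn nx; have [b0 Nb0] := local_comm_in_normal Nn nx.
apply: commgen_sub => // f g [Gf Gg [c fc gc]].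
have [t0 Gt0 t0c] := push b0 c.
have [e [Ge se Ket]] := correct_mod_comm c Gt0.
have tc y : ~~ inb b0 y -> inb c ((e * t0) y).
  move=> yb; rewrite bijM; apply/negPn/negP => yc; have ey := bij_inj (se _ yc).
  by rewrite ey t0c in yc.
have [K1 KM KV] := K_grp.
rewrite -(conjgK (e * t0) [~ f, g]); apply: NJ; last exact: KV.
rewrite conjRg; apply: Nb0; first exact/GJ/KG.
- exact/GJ/KG.
- exact: supp_inJ tc fc.
- exact: supp_inJ tc gc.
Qed.

Lemma normal_full n x : N n -> n x <> x -> forall f, K f -> N f.
Proof. by move=> Nn nx f /comm_sub_co_small; apply: co_small_in_normal Nn nx _. Qed.

End Normal.
End Simplicity.

(** * Finite words, balls and the prefix order *)

Section Words.
Variable d : nat.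
Local Notation word := (seq 'I_d).
Implicit Types (u v w p : word) (x y z : point d) (s : {perm 'I_d}).

Definition pre n x : word := mkseq x n.
Definition tl n x : point d := fun k => x (n + k)%N.
Definition inb w x : bool := pre (size w) x == w.
(** Incomparability for the prefix order, which makes the two balls disjoint. *)
Definition incomp u v := ~~ prefix u v && ~~ prefix v u.

Lemma incompC u v : incomp u v = incomp v u.
Proof. by rewrite /incomp andbC. Qed.

Lemma size_pre n x : size (pre n x) = n.
Proof. exact: size_mkseq. Qed.

Lemma preS n x : pre n.+1 x = x 0 :: pre n (tl 1 x).
Proof. by rewrite /pre /mkseq /= (iotaDl 1 0) -map_comp. Qed.

Lemma cat_pre n x : cat_pt (pre n x) (tl n x) = x.
Proof.
apply: funext; elim: n x => [//|n IH] x k; rewrite preS.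
by case: k => [//|k] /=; rewrite -[RHS](IH (tl 1 x)).
Qed.

Lemma cat_ptA u v y : cat_pt (u ++ v) y = cat_pt u (cat_pt v y).
Proof. by elim: u => //= a u ->. Qed.

Lemma pre_cat w y k : pre (size w + k) (cat_pt w y) = w ++ pre k y.
Proof.
by elim: w => //= a w IH; rewrite preS IH.
Qed.

Lemma pre_cat0 w y : pre (size w) (cat_pt w y) = w.
Proof. by rewrite -[in pre _](addn0 (size w)) pre_cat /= cats0. Qed.

Lemma tl_cat w y : tl (size w) (cat_pt w y) = y.
Proof. by apply: funext => k; rewrite /tl; elim: w. Qed.

Lemma act_cat s w y : act s (cat_pt w y) = cat_pt (map s w) (act s y).
Proof. by apply: funext => k; elim: w k => [//|a w IH] [|k] //=; apply: IH. Qed.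

Lemma act_actM s t y : act t (act s y) = act (s * t) y.
Proof. by apply: funext => k; rewrite /act permM. Qed.

Lemma act1 y : act 1 y = y.
Proof. by apply: funext => k; rewrite /act perm1. Qed.

Lemma inbP w x : reflect (exists y, x = cat_pt w y) (inb w x).
Proof.
apply: (iffP eqP) => [<-|[y ->]]; last exact: pre_cat0.
by exists (tl (size w) x); rewrite cat_pre.
Qed.

Lemma inb_cat w y : inb w (cat_pt w y).
Proof. by apply/inbP; exists y. Qed.

Lemma in_ballE w x : in_ball w x <-> inb w x.
Proof.
split=> [|/inbP [y ->]]; last by elim: w.
elim: w x => [//|a w IH] x /= [x0 /IH] /inbP [y tlx].
by apply/inbP; exists y; apply: funext => -[|k] //=; rewrite -tlx.
Qed.

Lemma inb_pre n x : inb (pre n x) x.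
Proof. by rewrite /inb size_pre. Qed.

Lemma inb_catl u v x : inb (u ++ v) x -> inb u x.
Proof. by case/inbP=> y ->; rewrite cat_ptA inb_cat. Qed.

Lemma inb_prefix u v x : prefix u v -> inb v x -> inb u x.
Proof. by case/prefixP=> p ->; apply: inb_catl. Qed.

Lemma pre_prefix m n x : m <= n -> prefix (pre m x) (pre n x).
Proof.
move=> mn; apply/prefixP; exists (pre (n - m) (tl m x)).
by have := pre_cat (pre m x) (tl m x) (n - m); rewrite size_pre cat_pre subnKC.
Qed.

Lemma inb_comparable u v x : inb u x -> inb v x -> size u <= size v -> prefix u v.
Proof. by move=> /eqP <- /eqP <-; rewrite !size_pre; apply: pre_prefix. Qed.

Lemma incomp_inb u v x : incomp u v -> inb u x -> inb v x = false.
Proof.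
move=> /andP [nuv nvu] ux; apply/negP => vx.
case: (leqP (size u) (size v)) => [uv|/ltnW uv].
  by rewrite (inb_comparable ux vx uv) in nuv.
by rewrite (inb_comparable vx ux uv) in nvu.
Qed.

Lemma inb_long u w y : size u <= size w -> inb u (cat_pt w y) = prefix u w.
Proof.
move=> uw; apply/idP/idP => [uy|/inb_prefix]; last by apply; apply: inb_cat.
exact: inb_comparable uy (inb_cat _ _) uw.
Qed.

Lemma incomp_size u v : size u = size v -> u != v -> incomp u v.
Proof.
move=> uv neq; rewrite /incomp !prefixE {1}uv take_size -uv take_size.
by rewrite neq eq_sym neq.
Qed.

Lemma prefix_total u v w : prefix u w -> prefix v w -> prefix u v || prefix v u.
Proof.
rewrite !prefixE => /eqP uw /eqP vw.
case: (leqP (size u) (size v)) => [uv|/ltnW uv].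
  by rewrite -vw take_takel // uw eqxx.
by rewrite -[in X in _ || X]uw take_takel // vw eqxx orbT.
Qed.

Lemma incomp_catl u v p : incomp u v -> incomp (u ++ p) v.
Proof.
move=> /andP [nuv nvu]; apply/andP; split.
  by apply: contra nuv; apply: catl_prefix.
apply/negP => /prefix_total /(_ (prefix_prefix u p)).
by rewrite (negPf nuv) (negPf nvu).
Qed.

Lemma incomp_catr u v p : incomp u v -> incomp u (v ++ p).
Proof. by rewrite incompC => /incomp_catl uv; rewrite incompC. Qed.

Lemma incomp_cat u v w : incomp (w ++ u) (w ++ v) = incomp u v.
Proof.
by elim: w => //= a w IH; rewrite -IH /incomp !prefix_cons eqxx.
Qed.

Lemma incomp_cons a b u v : a != b -> incomp (a :: u) (b :: v).
Proof. by move=> ab; rewrite /incomp !prefix_cons (negPf ab) eq_sym (negPf ab). Qed.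

End Words.

(** * Local forms, 3-cycles of balls, and letter permutations on a ball *)

Section LocalForm.
Variables (d : nat) (H : {group {perm 'I_d}}).
Local Notation word := (seq 'I_d).
Implicit Types (u v w p : word) (x y z : point d) (s : {perm 'I_d}).
Implicit Types (f g : bij (point d)).

Definition loc (g : point d -> point d) w v s :=
  s \in H /\ forall y, g (cat_pt w y) = cat_pt v (act s y).
(** For a bijection this is equivalent to [inV] (see [inVE]): continuity in both directions follows
    from the local forms. *)
Definition locally_H (g : point d -> point d) :=
  forall x, exists n v s, loc g (pre n x) v s.

Lemma loc_cat g w v s p : loc g w v s -> loc g (w ++ p) (v ++ map s p) s.
Proof. by case=> Hs gw; split=> // y; rewrite cat_ptA gw act_cat -cat_ptA. Qed.

Lemma locally_H_cont g : locally_H g -> continuous_pt g.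
Proof.
move=> gV x n; have [m [v [s [_ gm]]]] := gV x.
exists (m + n)%N => y xy.
have pre_xy : pre m x = pre m y.
  by apply/eq_in_map => k; rewrite mem_iota add0n => /andP [_ km]; apply: xy; lia.
move=> k kn; rewrite -(cat_pre m x) -(cat_pre m y) -pre_xy !gm.
have agr : agree n (act s (tl m x)) (act s (tl m y)).
  by move=> i ni; rewrite /act /tl xy //; lia.
elim: v k {gm} kn => [|a v IH] k kn /=; first exact: agr.
by case: k kn => // k kn; apply: IH; lia.
Qed.

Lemma locally_H1 : locally_H (1 : bij (point d)).
Proof.
by move=> x; exists 0, [::], 1; split=> [|y]; rewrite ?group1 //= act1.
Qed.

Lemma locally_HM f g : locally_H f -> locally_H g -> locally_H (f * g).
Proof.
move=> fV gV x; have [n [v [s gn]]] := gV x; have [m [u [t fm]]] := fV (g x).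
(* Reading [m] more letters of [x] makes the image word at least [m] long, hence an extension of the
   word on which the local form of [f] is known. *)
have xE : pre (n + m) x = pre n x ++ pre m (tl n x).
  by have := pre_cat (pre n x) (tl n x) m; rewrite size_pre cat_pre.
have [Hs gnm] := loc_cat (pre m (tl n x)) gn.
set v' := v ++ _ in gnm.
have : prefix (pre m (g x)) v'.
  apply: (@inb_comparable _ _ _ (g x)); first exact: inb_pre.
    by rewrite -(cat_pre (n + m) x) xE gnm inb_cat.
  by rewrite size_pre size_cat size_map size_pre leq_addl.
case/prefixP => r v'E.
have [Ht fm'] := loc_cat r fm.
exists (n + m)%N, (u ++ map t r), (s * t).
by split=> [|y]; rewrite ?groupM // xE bijM gnm v'E fm' act_actM.
Qed.

Lemma locV f w v s : loc f w v s -> loc f^-1 v w s^-1.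
Proof.
case=> Hs fw; split=> [|y]; first by rewrite groupV.
by apply: (@bij_inj _ f); rewrite bijVK fw act_actM mulVg act1.
Qed.

Lemma locally_HV f : locally_H f -> locally_H f^-1.
Proof.
move=> fV x; have [n [v [s fn]]] := fV (f^-1 x).
exists (size v), (pre n (f^-1 x)), s^-1.
suff -> : pre (size v) x = v by apply: locV.
apply/eqP; rewrite -/(inb v x) -[x](bijVK f) -(cat_pre n (f^-1 x)).
by case: fn => _ ->; apply: inb_cat.
Qed.

Lemma inVE f : inV H f <-> locally_H f.
Proof.
split=> [[_ fV] x | fV].
  have [w [v [s [Hs [/in_ballE /eqP wx fw]]]]] := fV x.
  by exists (size w), v, s; rewrite wx.
split; last first.
  move=> x; have [n [v [s [Hs fn]]]] := fV x.
  by exists (pre n x), v, s; split=> //; split=> //; apply/in_ballE/inb_pre.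
exists f^-1; split; first exact: bijK.
split; first exact: bijVK.
by split; apply: locally_H_cont => //; apply: locally_HV.
Qed.

(* Koenig's lemma: otherwise one could follow bad letters to an infinite word near
   which [g] has no local form. *)
Lemma locally_H_unif (o : 'I_d) g : locally_H g ->
  exists N, forall w, N <= size w -> exists v s, loc g w v s.
Proof.
move=> gV.
pose P w := exists N, forall p, N <= size p -> exists v s, loc g (w ++ p) v s.
apply: (contrapT (P := P [::])) => nP0.
(* The implication form gives a letter for every word, so that choice applies; read
   contrapositively, it extends a bad word to a bad word. *)
have step w : exists a, P (rcons w a) -> P w.
  apply: contrapT => nex.
  have /choice [F FP] : forall a, exists N, forall p, N <= size p ->
      exists v s, loc g (rcons w a ++ p) v s.
    move=> a; apply: contrapT => nPa; apply: nex; exists a => Pa.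
    by case: nPa; case: Pa => N PN; exists N.
  apply: nex; exists o => _; exists (\max_a F a).+1 => -[//|a p] ap.
  by rewrite -cat_rcons; apply: FP; rewrite ltnS in ap; apply: leq_trans ap; apply: leq_bigmax.
have {step} [F FP] := choice step.
pose W n := iter n (fun w => rcons w (F w)) [::].
have nPW n : ~ P (W n) by elim: n => [//|n IH] /FP.
have preW n : pre n (fun n => F (W n)) = W n.
  elim: n => [//|n IH]; rewrite /pre mkseqS -/(pre _ _) IH //.
have [n [v [s gn]]] := gV (fun n => F (W n)).
apply: (nPW n); exists 0 => p _; rewrite -preW.
by exists (v ++ map s p), s; apply: loc_cat.
Qed.

(** A 3-cycle of balls by prefix replacement. Its order divides 3, so its sign is trivial and it
    lies in the group for every [d] and [H]. *)
Definition rot3 (t : bij (point d)) u v w :=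
  [/\ forall y, t (cat_pt u y) = cat_pt v y, forall y, t (cat_pt v y) = cat_pt w y,
      forall y, t (cat_pt w y) = cat_pt u y &
      forall x, ~~ inb u x -> ~~ inb v x -> ~~ inb w x -> t x = x].

Lemma rot3_exists u v w : incomp u v -> incomp v w -> incomp u w ->
  exists t, rot3 t u v w.
Proof.
move: u v w; pose c u v w x := if inb u x then cat_pt v (tl (size u) x)
  else if inb v x then cat_pt w (tl (size v) x)
  else if inb w x then cat_pt u (tl (size w) x) else x.
have cu u v w y : c u v w (cat_pt u y) = cat_pt v y by rewrite /c inb_cat tl_cat.
have cv u v w y : incomp u v -> c u v w (cat_pt v y) = cat_pt w y.
  by rewrite incompC /c => uv; rewrite (incomp_inb uv) inb_cat ?tl_cat.
have cw u v w y : incomp v w -> incomp u w -> c u v w (cat_pt w y) = cat_pt u y.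
  rewrite incompC (incompC u) /c => vw uw.
  by rewrite (incomp_inb uw) ?(incomp_inb vw) inb_cat ?tl_cat.
have co u v w x : ~~ inb u x -> ~~ inb v x -> ~~ inb w x -> c u v w x = x.
  by rewrite /c => /negPf -> /negPf -> /negPf ->.
(* The inverse is the same formula for the reversed cycle, so one computation gives both
   cancellation laws. *)
have cK u v w : incomp u v -> incomp v w -> incomp u w -> cancel (c u v w) (c w v u).
  move=> uv vw uw x; have wv : incomp w v by rewrite incompC.
  have vu : incomp v u by rewrite incompC. have wu : incomp w u by rewrite incompC.
  case: (boolP (inb u x)) => [/inbP [y ->]|nu]; first by rewrite cu cv.
  case: (boolP (inb v x)) => [/inbP [y ->]|nv]; first by rewrite cv // cu.
  case: (boolP (inb w x)) => [/inbP [y ->]|nw]; first by rewrite cw // cw.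
  by rewrite !co.
move=> u v w uv vw uw; have wv : incomp w v by rewrite incompC.
have vu : incomp v u by rewrite incompC. have wu : incomp w u by rewrite incompC.
exists (Bij (cK _ _ _ uv vw uw) (cK _ _ _ wv vu wu)); split=> /=.
- exact: cu.
- by move=> y; apply: cv.
- by move=> y; apply: cw.
- exact: co.
Qed.

Lemma rot3_cube t u v w : rot3 t u v w -> t * (t * t) = 1.
Proof.
case=> tu tv tw to; apply: bij_ext => x; rewrite !bijM.
case: (boolP (inb u x)) => [/inbP [y ->]|nu]; first by rewrite tu tv tw.
case: (boolP (inb v x)) => [/inbP [y ->]|nv]; first by rewrite tv tw tu.
case: (boolP (inb w x)) => [/inbP [y ->]|nw]; first by rewrite tw tu tv.
by rewrite !to.
Qed.

Lemma inb_pre_cat u n x y : size u <= n -> inb u (cat_pt (pre n x) y) = inb u x.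
Proof.
move=> un; rewrite inb_long ?size_pre //; apply/idP/idP.
  by move/inb_prefix; apply; apply: inb_pre.
by move=> ux; apply: (inb_comparable ux (inb_pre n x)); rewrite size_pre.
Qed.

Lemma loc_translate (g : point d -> point d) u v s x : s \in H ->
  (forall y, g (cat_pt u y) = cat_pt v (act s y)) -> inb u x ->
  exists n v s, loc g (pre n x) v s.
Proof. by move=> Hs gu /eqP ux; exists (size u), v, s; rewrite ux. Qed.

Lemma rot3_locally_H t u v w : rot3 t u v w -> locally_H t.
Proof.
case=> tu tv tw to x.
case: (boolP (inb u x)) => [ux|nu].
  by apply: loc_translate (group1 H) _ ux => y; rewrite act1.
case: (boolP (inb v x)) => [vx|nv].
  by apply: loc_translate (group1 H) _ vx => y; rewrite act1.
case: (boolP (inb w x)) => [wx|nw].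
  by apply: loc_translate (group1 H) _ wx => y; rewrite act1.
(* A prefix this long has its ball either inside or disjoint from each of the three balls. *)
pose n := (size u + size v + size w)%N; exists n, (pre n x), 1.
split=> [|y]; rewrite ?group1 // act1; apply: to; rewrite inb_pre_cat //; lia.
Qed.

Definition twistf u s x := if inb u x then cat_pt u (act s (tl (size u) x)) else x.

Lemma twistf_cat u s y : twistf u s (cat_pt u y) = cat_pt u (act s y).
Proof. by rewrite /twistf inb_cat tl_cat. Qed.

Lemma twistf_out u s x : ~~ inb u x -> twistf u s x = x.
Proof. by rewrite /twistf => /negPf ->. Qed.

Lemma twistfM u s s' x : twistf u (s * s') x = twistf u s' (twistf u s x).
Proof.
case: (boolP (inb u x)) => [/inbP [y ->]|ux]; last by rewrite !twistf_out.
by rewrite !twistf_cat act_actM.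
Qed.

Lemma twistf1 u x : twistf u 1 x = x.
Proof.
case: (boolP (inb u x)) => [/inbP [y ->]|ux]; last by rewrite twistf_out.
by rewrite twistf_cat act1.
Qed.

Lemma twistfK u s : cancel (twistf u s) (twistf u s^-1).
Proof. by move=> x; rewrite -twistfM mulgV twistf1. Qed.

Lemma twistfVK u s : cancel (twistf u s^-1) (twistf u s).
Proof. by move=> x; rewrite -twistfM mulVg twistf1. Qed.

Definition twist u s : bij (point d) := Bij (@twistfK u s) (@twistfVK u s).

Lemma twist_locally_H u s : s \in H -> locally_H (twist u s).
Proof.
move=> Hs x; case: (boolP (inb u x)) => [ux|nu].
  exact: loc_translate Hs (twistf_cat u s) ux.
exists (size u), (pre (size u) x), 1.
by split=> [|y]; rewrite ?group1 // act1; apply: twistf_out; rewrite inb_pre_cat.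
Qed.

End LocalForm.

(** * Parity of inversions between two tournaments *)

Section Inversions.
Implicit Types I J : finType.

Definition tournament I (a : rel I) :=
  irreflexive a /\ forall i j, i != j -> a j i = ~~ a i j.

(** For tournaments this is the parity of the number of unordered pairs on which [a] and [b]
    disagree, each such pair being counted in exactly one order. *)
Definition invs I (a b : rel I) : bool :=
  \big[addb/false]_i \big[addb/false]_j (a i j && b j i).

Lemma eq_invs I (a a' b b' : rel I) : a =2 a' -> b =2 b' -> invs a b = invs a' b'.
Proof. by move=> aa bb; apply: eq_bigr => i _; apply: eq_bigr => j _; rewrite aa bb. Qed.

Lemma invs_trans I (a b c : rel I) : tournament a -> tournament b -> tournament c ->
  invs a c = invs a b (+) invs b c.
Proof.
move=> [ai aT] [bi bT] [ci cT].
pose S (F : I -> I -> bool) := \big[addb/false]_i \big[addb/false]_j F i j.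
have SD F F' : S (fun i j => F i j (+) F' i j) = S F (+) S F'.
  by rewrite /S -big_split; apply: eq_bigr => i _; rewrite big_split.
(* For each pair the defect of additivity is [F i j (+) F j i], and exchanging the two sums makes
   its total vanish. *)
pose F i j := [&& a i j, b j i & c i j].
have ST : S (fun i j => F j i) = S F by rewrite /S exchange_big.
have : S (fun i j => F i j (+) F j i) = false by rewrite SD ST addbb.
have -> : S (fun i j => F i j (+) F j i) = S (fun i j =>
    (a i j && c j i) (+) ((a i j && b j i) (+) (b i j && c j i))).
  apply: eq_bigr => i _; apply: eq_bigr => j _; rewrite /F.
  have [->|ij] := eqVneq i j; first by rewrite ai bi.
  rewrite (aT _ _ ij) (bT _ _ ij) (cT _ _ ij).
  by case: (a i j); case: (b i j); case: (c i j).
rewrite !SD -![S _]/(invs _ _).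
by case: (invs a c); case: (invs a b); case: (invs b c).
Qed.

Lemma invs_reindex I J (r : J -> I) (a b : rel I) : bijective r ->
  invs (fun i j => a (r i) (r j)) (fun i j => b (r i) (r j)) = invs a b.
Proof.
move=> rB; rewrite [RHS](reindex r); last exact: onW_bij.
by apply: eq_bigr => i _; rewrite [RHS](reindex r) //; apply: onW_bij.
Qed.

Lemma tperm_conj (T : finType) (x y z w : T) : x != y -> z != w ->
  exists s : {perm T}, tperm x y ^ s = tperm z w.
Proof.
(* The first factor sends [x] to [z]; the second sends the current image of [y] to [w] and leaves
   [z] alone. *)
move=> xy zw; exists (tperm x z * tperm (tperm x z y) w).
have zy : z != tperm x z y by rewrite -{1}(tpermL x z) (inj_eq perm_inj).
by rewrite tpermJ !permM tpermL tpermL tpermD // eq_sym.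
Qed.

(** * Homomorphisms from a symmetric group to the group of order two *)

Section Character.
Variables (T : finType) (chi : {perm T} -> bool).
Hypothesis chiM : forall s t, chi (s * t) = chi s (+) chi t.

Lemma char_tperm x y z w : x != y -> z != w -> chi (tperm x y) = chi (tperm z w).
Proof.
move=> xy zw; have [s <-] := tperm_conj xy zw.
rewrite conjgE !chiM; have := chiM 1 1; rewrite mul1g addbb => chi1.
have: chi (s^-1 * s) = false by rewrite mulVg.
by rewrite chiM; case: (chi s); case: (chi s^-1); case: (chi (tperm x y)).
Qed.

(** Transpositions generate and are all conjugate, so such a homomorphism is determined by its value
    on one of them. *)
Lemma char_odd_perm z w : z != w -> forall s, chi s = odd_perm s && chi (tperm z w).
Proof.
move=> zw s; have [ts -> dts] := prod_tpermP s; rewrite odd_perm_prod //.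
have chi1 : chi 1 = false by have := chiM 1 1; rewrite mul1g addbb.
elim: ts dts => [|[x y] ts IH] /=; first by rewrite big_nil.
case/andP=> /= xy /IH; rewrite big_cons chiM /= => ->.
rewrite (char_tperm xy zw).
by case: (odd _); case: (chi _).
Qed.

Lemma char_even_perm s : ~~ odd_perm s -> chi s = false.
Proof.
move=> es; have chi1 : chi 1 = false by have := chiM 1 1; rewrite mul1g addbb.
have [ts sE dts] := prod_tpermP s.
case: ts sE dts => [->|[x y] ts _ /andP [xy _]]; first by rewrite big_nil.
by rewrite (char_odd_perm xy) (negPf es).
Qed.

End Character.

(** Additivity is applied through the order pulled back along [f], and the second term is reindexed
    by [f]. *)
Lemma invs_comp I (a : rel I) (f g : {perm I}) : tournament a ->
  invs a (fun i j => a ((f * g) i) ((f * g) j)) =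
  invs a (fun i j => a (f i) (f j)) (+) invs a (fun i j => a (g i) (g j)).
Proof.
move=> [ai aT].
have tr (h : {perm I}) : tournament (fun i j => a (h i) (h j)).
  by split=> [i|i j ij]; [apply: ai | apply: aT; rewrite (inj_eq perm_inj)].
rewrite (invs_trans _ (tr f) (tr _)) //; congr addb.
rewrite -[RHS](invs_reindex _ _ (injF_bij (@perm_inj _ f))).
by apply: eq_invs => i j; rewrite ?permM.
Qed.

(** The inversion parity is a homomorphism, and the transposition of 0 and 1 has exactly one
    inversion. *)
Lemma invs_ord m (tau : 'S_m) :
  invs (fun i j : 'I_m => i < j)%N (fun i j : 'I_m => tau i < tau j)%N = odd_perm tau.
Proof.
pose chi (s : 'S_m) := invs (fun i j : 'I_m => i < j)%N (fun i j => s i < s j)%N.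
have tl : tournament (fun i j : 'I_m => i < j)%N.
  by split=> [i|i j ij] /=; [rewrite ltnn | rewrite -leqNgt ltn_neqAle eq_sym (inj_eq val_inj) ij].
have chiM s t : chi (s * t) = chi s (+) chi t by apply: invs_comp.
rewrite -/(chi tau); case: (boolP (odd_perm tau)) => [ot|]; last exact: char_even_perm.
have m2 : 1 < m.
  rewrite ltnNge; apply/negP => m1.
  suff t1 : tau = 1 by rewrite t1 odd_perm1 in ot.
  by apply/permP => i; apply: val_inj; rewrite perm1 /=; have := ltn_ord i; have := ltn_ord (tau i); lia.
pose i0 := Ordinal (ltnW m2); pose i1 := Ordinal m2.
have i01 : i0 != i1 by [].
have E (i j : 'I_m) : ((i < j) && (tperm i0 i1 j < tperm i0 i1 i))%N
    = (i == i0) && (j == i1).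
  have [v0 v1] : i0 = 0%N :> nat /\ i1 = 1%N :> nat by [].
  case: (tpermP i0 i1 i) => [->|->|/eqP + /eqP]; case: (tpermP i0 i1 j) => [->|->|/eqP + /eqP];
    rewrite -?val_eqE /=; lia.
rewrite (char_odd_perm chiM i01) ot /= /chi /invs (eq_bigr (fun i => i == i0)) => [|i _].
  by rewrite (bigD1 i0) //= big1 ?addbF ?eqxx // => i /negPf.
rewrite (eq_bigr (fun j => (i == i0) && (j == i1))) => [|j _]; last exact: E.
by rewrite (bigD1 i1) //= eqxx andbT big1 ?addbF // => j /negPf ->; rewrite andbF.
Qed.

End Inversions.

(** * Lexicographic order on infinite words *)

Section Lex.
Variable d : nat.
Local Notation word := (seq 'I_d).
Implicit Types (u v w p : word) (x y z : point d).

Definition ptlt x y : bool := `[< exists n, agree n x y /\ (x n < y n)%N >].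

Lemma point_neq x y : x <> y -> exists n, agree n x y /\ x n != y n.
Proof.
move=> xy; have [n0 n0P] : exists n, x n != y n.
  apply: contrapT => nex; apply: xy; apply: funext => n.
  by apply/eqP/negPn/negP => xyn; apply: nex; exists n.
have ex : exists n, x n != y n by exists n0.
exists (ex_minn ex); case: ex_minnP => n xyn minn; split=> // k kn.
by apply/eqP/negPn/negP => /minn; rewrite leqNgt kn.
Qed.

Lemma ptlt_first n x y : agree n x y -> x n != y n -> ptlt x y = (x n < y n)%N.
Proof.
move=> ag xyn; apply/asboolP/idP => [[m [agm xym]]|xyn']; last by exists n.
case: (ltngtP m n) => [mn|nm|<- //]; first by rewrite ag ?ltnn in xym.
by rewrite agm ?eqxx in xyn.
Qed.

Lemma ptltxx : irreflexive ptlt.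
Proof. by move=> x; apply/asboolP => -[n [_]]; rewrite ltnn. Qed.

Lemma ptltNge x y : x <> y -> ptlt y x = ~~ ptlt x y.
Proof.
move=> /point_neq [n [ag xyn]].
rewrite (ptlt_first ag xyn) (@ptlt_first n) ?(eq_sym (y n)) //.
  by rewrite -leqNgt ltn_neqAle eq_sym (inj_eq val_inj) xyn.
by move=> k kn; rewrite ag.
Qed.

Lemma ptlt_trans : transitive ptlt.
Proof.
move=> y x z /asboolP [n [agn xyn]] /asboolP [m [agm yzm]].
apply/asboolP; case: (ltngtP n m) => [nm|mn|nm].
- by exists n; split=> [k kn|]; rewrite -?agm // ?agn //; lia.
- by exists m; split=> [k km|]; rewrite ?agn // ?agm //; lia.
exists n; split=> [k kn|]; first by rewrite agn // agm // -nm.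
by rewrite nm in xyn *; apply: ltn_trans yzm.
Qed.

Lemma ptlt_cons x y : ptlt x y = (x 0 < y 0)%N || (x 0 == y 0) && ptlt (tl 1 x) (tl 1 y).
Proof.
have [xy0|xy0] := eqVneq; last by rewrite orbF (@ptlt_first 0).
rewrite {1}xy0 ltnn /=; apply/asboolP/asboolP => -[n [ag xyn]].
  case: n => [|n] in ag xyn *; first by rewrite xy0 ltnn in xyn.
  by exists n; split=> // k kn; apply: ag.
by exists n.+1; split=> // -[//|k] kn; apply: ag.
Qed.

Lemma ptlt_cat w x y : ptlt (cat_pt w x) (cat_pt w y) = ptlt x y.
Proof. by elim: w => //= a w IH; rewrite ptlt_cons /= ltnn eqxx /= -[RHS]IH. Qed.

Lemma ptlt_incomp u v x y : incomp u v -> ptlt (cat_pt u x) (cat_pt v y) = lex_lt u v.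
Proof.
elim: u v => [|a u IH] [|b v]; rewrite ?/incomp ?prefix0s ?prefixs0 //=.
rewrite ptlt_cons /=; have [->|ab] := eqVneq a b; last by rewrite !orbF.
by rewrite ltnn /= => uv; apply: IH.
Qed.

(** Points of disjoint balls compare as the two words do, so representatives may be exchanged
    freely. *)
Lemma ptlt_balls u v x y x' y' : incomp u v ->
  inb u x -> inb v y -> inb u x' -> inb v y' -> ptlt x y = ptlt x' y'.
Proof.
move=> uv /inbP [? ->] /inbP [? ->] /inbP [? ->] /inbP [? ->].
by rewrite !ptlt_incomp.
Qed.

Definition pts_lt (I : finType) (x : I -> point d) : rel I := fun i j => ptlt (x i) (x j).

Lemma pts_lt_tour (I : finType) (x : I -> point d) : injective x -> tournament (pts_lt x).
Proof.
move=> xI; split=> [i|i j ij]; first exact: ptltxx.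
by apply: ptltNge => /xI /eqP; rewrite (negPf ij).
Qed.

End Lex.

(** * Counting the words with a given prefix modulo 2 *)

Section BlockParity.
Variable d : nat.

Lemma big_tuple_cons n (F : n.+1.-tuple 'I_d -> bool) :
  \big[addb/false]_w F w =
  \big[addb/false]_a \big[addb/false]_(w : n.-tuple 'I_d) F (cons_tuple a w).
Proof.
rewrite pair_big /= (reindex (fun p : 'I_d * n.-tuple 'I_d => cons_tuple p.1 p.2)) //.
exists (fun w => (thead w, behead_tuple w)) => [[a w]|w] _ /=; last first.
  by rewrite [RHS]tuple_eta.
by congr pair; apply: val_inj.
Qed.

(** The number of such words is a power of [d], hence odd. *)
Lemma odd_block n (v : seq 'I_d) : odd d -> size v <= n ->
  \big[addb/false]_(w : n.-tuple 'I_d) prefix v w = true.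
Proof.
move=> dodd; elim: n v => [|n IH] [|a v] // vn.
- by rewrite (bigD1 [tuple]) //= big1 // => w; rewrite tuple0.
- rewrite big_tuple_cons (eq_bigr (fun=> true)) => [|a _].
    rewrite big_const card_ord -[RHS]dodd.
    by elim: (d) => //= k ->.
  by rewrite -[RHS](IH [::]) //; apply: eq_bigr => w _; rewrite !prefix0s.
rewrite big_tuple_cons (bigD1 a) //= [X in _ (+) X]big1 => [|b ba].
  rewrite addbF -[RHS](IH v) //; apply: eq_bigr => w _ /=.
  by rewrite eqxx.
by apply: big1 => w _ /=; rewrite eq_sym (negPf ba).
Qed.

End BlockParity.

(** * The inversion sign on words of a fixed length *)

Section Sign.
Variables (d : nat) (o : 'I_d).
Local Notation word := (seq 'I_d).
Implicit Types (u v w p : word) (x y z : point d) (s h : {perm 'I_d}).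
Implicit Types (f g : bij (point d)).

(* A word is represented by the point [lp w] continuing it with the letter [o], so that
   images of words of different lengths can be compared lexicographically. *)
Definition lp w : point d := cat_pt w (fun=> o).

Definition sg n (g : point d -> point d) : bool :=
  invs (pts_lt (fun w : n.-tuple 'I_d => lp w))
       (pts_lt (fun w : n.-tuple 'I_d => g (lp w))).

Lemma pre_lp n (w : n.-tuple 'I_d) : pre n (lp w) = w.
Proof. by rewrite -[n in pre n](size_tuple w) pre_cat0. Qed.

Lemma lp_inj n : injective (fun w : n.-tuple 'I_d => lp w).
Proof. by move=> w w' ww; apply: val_inj; rewrite /= -pre_lp ww pre_lp. Qed.

Lemma tuple_incomp n (w w' : n.-tuple 'I_d) : w != w' -> incomp w w'.
Proof. by move=> ww; apply: incomp_size; rewrite ?size_tuple. Qed.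

Lemma inb_tuple n (w : n.-tuple 'I_d) x : inb w x = (pre n x == w).
Proof. by rewrite /inb size_tuple. Qed.

Lemma pre_take m n x : m <= n -> pre m x = take m (pre n x).
Proof. by move=> /(pre_prefix x); rewrite prefixE size_pre => /eqP. Qed.

Lemma twistf_pre n v s x y : size v <= n -> pre n x = pre n y ->
  pre n (twistf v s x) = pre n (twistf v s y).
Proof.
move=> vn xy; have vxy : inb v x = inb v y by rewrite /inb !(pre_take _ vn) xy.
case: (boolP (inb v x)) => vx; last by rewrite !twistf_out // -vxy.
move: xy; have vy := vx; rewrite vxy in vy.
have [/inbP [x' ->] /inbP [y' ->]] := (vx, vy).
rewrite !twistf_cat -(subnKC vn) !pre_cat => /eqP; rewrite eqseq_cat // eqxx /= => /eqP xy.
congr cat; apply/eq_in_map => k; rewrite mem_iota add0n => /andP [_ kn]; rewrite /act.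
by move/eq_in_map: xy => /(_ k) ->; rewrite ?mem_iota.
Qed.

Definition twist_tuple n v s (w : n.-tuple 'I_d) : n.-tuple 'I_d :=
  [tuple of pre n (twistf v s (lp w))].

Lemma twist_tupleK n v s : size v <= n -> cancel (@twist_tuple n v s) (twist_tuple v s^-1).
Proof.
move=> vn w; apply: val_inj; rewrite /= -[RHS]pre_lp -[in RHS](twistfK v s (lp w)).
by apply: twistf_pre; rewrite ?pre_lp.
Qed.

(** For fixed [v] and [n] the sign is a homomorphism in [s], so it vanishes on even permutations. *)
Lemma sg_twist n v s : size v <= n -> ~~ odd_perm s -> sg n (twistf v s) = false.
Proof.
move=> vn; move: s; apply: char_even_perm => s t.
have inj_tw s' : injective (fun w : n.-tuple 'I_d => twistf v s' (lp w)).
  by move=> w w' /(can_inj (twistfK v s')) /lp_inj.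
rewrite /sg (invs_trans _ (pts_lt_tour (inj_tw s))) //; first last.
- exact/pts_lt_tour/inj_tw.
- exact/pts_lt_tour/lp_inj.
congr addb.
(* Reindexing by the permutation of words that the twist by [s] induces turns the second term into
   the sign of the twist by [t]. *)
have rB : bijective (@twist_tuple n v s).
  by exists (twist_tuple v s^-1); first exact: twist_tupleK;
    rewrite -{2}[s]invgK; apply: twist_tupleK.
rewrite -[RHS](invs_reindex _ _ rB); apply: eq_invs => w w'.
  have [->|ww] := eqVneq w w'; first by rewrite /pts_lt !ptltxx.
  have tww : twist_tuple v s w != twist_tuple v s w' by rewrite bij_eq.
  by apply: (ptlt_balls (tuple_incomp tww)); rewrite ?inb_cat // inb_tuple.
have [->|ww] := eqVneq w w'; first by rewrite /pts_lt !ptltxx.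
have tww : twist_tuple v (s * t) w != twist_tuple v (s * t) w'.
  by apply: contra ww => /eqP /(can_inj (twist_tupleK _ vn)) ->.
apply: (ptlt_balls (tuple_incomp tww)); rewrite inb_tuple //= twistfM.
  by apply/eqP/twistf_pre => //; rewrite pre_lp.
by apply/eqP/twistf_pre => //; rewrite pre_lp.
Qed.

Lemma twistf_lt_out n v s (w w' : n.-tuple 'I_d) : size v <= n ->
  ~~ (inb v (lp w) && inb v (lp w')) ->
  ptlt (twistf v s (lp w)) (twistf v s (lp w')) = ptlt (lp w) (lp w').
Proof.
move=> vn; have twb y : inb v y -> inb v (twistf v s y).
  by case/inbP=> z ->; rewrite twistf_cat inb_cat.
have vinc (t : n.-tuple 'I_d) : ~~ inb v (lp t) -> incomp v t.
  rewrite inb_long ?size_tuple // => vt; rewrite /incomp vt /=.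
  apply: contra vt => tv; have vt : size v = size t.
    by apply/eqP; rewrite eqn_leq (size_prefix tv) size_tuple vn.
  by move: tv; rewrite !prefixE -vt take_size => /eqP ->; rewrite take_size.
case: (boolP (inb v (lp w))) => [vw /= vw'|vw _].
  rewrite (twistf_out _ vw').
  by apply: (ptlt_balls (vinc _ vw')); rewrite ?twb // inb_cat.
rewrite (twistf_out _ vw).
case: (boolP (inb v (lp w'))) => [vw'|vw']; last by rewrite twistf_out.
have wv : incomp w v by rewrite incompC vinc.
by apply: (ptlt_balls wv); rewrite ?twb // inb_cat.
Qed.

Lemma disjoint_incomp (I : eqType) (t : I -> word) :
  (forall i j y, inb (t i) y -> inb (t j) y -> i = j) ->
  forall i j, i != j -> incomp (t i) (t j).
Proof.
move=> tdisj i j; apply: contraR; rewrite negb_and !negbK => /orP [] pre_t; apply/eqP.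
  by apply: (tdisj _ _ (lp (t j))); rewrite ?inb_cat // (inb_prefix pre_t) ?inb_cat.
by apply: (tdisj _ _ (lp (t i))); rewrite ?inb_cat // (inb_prefix pre_t) ?inb_cat.
Qed.

Lemma image_ball g v u s y : (forall z, g (cat_pt v z) = cat_pt u (act s z)) ->
  inb u y -> inb v (g^-1 y).
Proof.
by move=> gv /inbP [z ->]; rewrite -[z]act1 -(mulVg s) -act_actM -gv bijK inb_cat.
Qed.

(* Splitting a ball into an odd number of balls, on which [g] acts through an even
   letter permutation, does not change the parity of the number of inversions. *)
Lemma sg_table g (I : finType) (v u : I -> word) (h : I -> {perm 'I_d})
    (x : I -> point d) n :
  odd d -> (forall i, ~~ odd_perm (h i)) ->
  (forall i y, g (cat_pt (v i) y) = cat_pt (u i) (act (h i) y)) ->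
  (forall y, exists i, inb (v i) y) ->
  (forall i j y, inb (v i) y -> inb (v j) y -> i = j) ->
  (forall i, inb (v i) (x i)) -> (forall i, size (v i) <= n) ->
  sg n g = invs (pts_lt x) (pts_lt (fun i => g (x i))).
Proof.
move=> dodd hE gv vcov vdisj vx vn.
have [b bP] := choice (fun w : n.-tuple 'I_d => vcov (lp w)).
have vI := disjoint_incomp vdisj.
have gin i y : inb (v i) y -> inb (u i) (g y) by case/inbP=> z ->; rewrite gv inb_cat.
have uI : forall i j, i != j -> incomp (u i) (u j).
  by apply: disjoint_incomp => i j y /(image_ball (gv i)) yi /(image_ball (gv j)); apply: vdisj.
pose F (w w' : n.-tuple 'I_d) := ptlt (lp w) (lp w') && ptlt (g (lp w')) (g (lp w)).
pose c i j := ptlt (x i) (x j) && ptlt (g (x j)) (g (x i)).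
(* Between different blocks an inversion depends only on the blocks; the added sum isolates the
   pairs inside one block. *)
have FE (w w' : n.-tuple 'I_d) : F w w' = c (b w) (b w') (+) \big[addb/false]_i
    ([&& b w == i, b w' == i & F w w']).
  rewrite (bigD1 (b w)) //= eqxx /= big1 ?addbF => [|i]; last first.
    by rewrite eq_sym => /negPf ->.
  have [bw|bw] := eqVneq; first by rewrite bw /c ptltxx addFb.
  rewrite addbF /F /c; congr andb.
    by apply: (ptlt_balls (vI _ _ _) (bP w) (bP w')) => //; rewrite eq_sym.
  by apply: (ptlt_balls (uI _ _ bw)); apply: gin.
have bE (w : n.-tuple 'I_d) i : (b w == i) = prefix (v i) w.
  rewrite -(@inb_long _ (v i) w (fun=> o)) ?size_tuple //.
  by apply/eqP/idP => [<-|vi]; [exact: bP | exact: vdisj (bP w) vi].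
have block (phi : I -> bool) : \big[addb/false]_w phi (b w) = \big[addb/false]_i phi i.
  rewrite (partition_big b xpredT) //=; apply: eq_bigr => i _.
  rewrite (eq_bigr (fun=> phi i)) => [|w /eqP -> //].
  transitivity ((\big[addb/false]_(w : n.-tuple 'I_d) prefix (v i) w) && phi i).
    rewrite big_distrl big_mkcond /=; apply: eq_bigr => w _; rewrite bE.
    by case: prefix.
  by rewrite odd_block.
(* Inside the block of [v i] the inversions of [g] are those of the twist by [h i], which is
   even. *)
have inner i : \big[addb/false]_w \big[addb/false]_w'
    [&& b w == i, b w' == i & F w w'] = false.
  transitivity (sg n (twistf (v i) (h i))); last exact: sg_twist.
  apply: eq_bigr => w _; apply: eq_bigr => w' _.
  have [->|ww] := eqVneq w w'; first by rewrite /F /pts_lt !ptltxx !andbF.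
  rewrite !bE -!(@inb_long _ _ _ (fun=> o)) ?size_tuple // -!/(lp _) /F /pts_lt.
  case: (boolP (inb (v i) (lp w) && inb (v i) (lp w'))) => [/andP [vw vw']|nvw].
    rewrite vw vw' /=; move: vw vw' => /inbP [y ->] /inbP [z ->].
    by rewrite !gv !twistf_cat !ptlt_cat.
  rewrite andbA (negPf nvw) andFb (twistf_lt_out _ (vn i)) 1?andbC //.
  have lww : lp w <> lp w' by move/lp_inj/eqP; rewrite (negPf ww).
  by rewrite (ptltNge lww) andNb.
transitivity (\big[addb/false]_w \big[addb/false]_w' F w w'); first by [].
under eq_bigr => w _ do under eq_bigr => w' _ do rewrite FE.
under eq_bigr => w _ do rewrite big_split /=.
rewrite big_split /= [X in _ (+) X](_ : _ = false) ?addbF.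
  under eq_bigr => w _ do rewrite (block (c (b w))).
  exact: (block (fun i => \big[addb/false]_j c i j)).
under eq_bigr => w _ do rewrite exchange_big.
by rewrite exchange_big big1.
Qed.

(** The rank [k i] counts the smaller elements; it is injective, and its inverse lists the index set
    in increasing order. *)
Lemma lt_enum (I : finType) (x : I -> point d) : injective x ->
  exists (r : 'I_#|I| -> I) (k : I -> 'I_#|I|),
    [/\ cancel r k, cancel k r & forall i j : 'I_#|I|, (i < j)%N = ptlt (x (r i)) (x (r j))].
Proof.
move=> xI; pose R i := [set j | ptlt (x j) (x i)].
have Rlt i : #|R i| < #|I|.
  by rewrite -cardsT proper_card // properT; apply/eqP => /setP /(_ i); rewrite !inE ptltxx.
pose k i : 'I_#|I| := Ordinal (Rlt i).
have kmono i j : ptlt (x i) (x j) -> (k i < k j)%N.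
  move=> ij; apply: proper_card; apply/properP; split.
    by apply/subsetP => l; rewrite !inE => /ptlt_trans; apply.
  by exists i; rewrite !inE // ptltxx.
have kE i j : (k i < k j)%N = ptlt (x i) (x j).
  apply/idP/idP => [kij|]; last exact: kmono.
  have xij : x i <> x j by move/xI => ij; rewrite ij ltnn in kij.
  by apply/negPn; rewrite -(ptltNge xij); apply/negP => /kmono; rewrite ltnNge ltnW.
have kI : injective k.
  move=> i j kij; apply: contrapT => ij.
  have xij : x i <> x j by move/xI.
  by have := ptltNge xij; rewrite -!kE kij ltnn.
have [r rK kK] : bijective k by apply: inj_card_bij => //; rewrite card_ord.
by exists r, k; split=> // i j; rewrite -kE !kK.
Qed.

Lemma sorted_ptlt m (t : 'I_m -> word) i j y z :
  (forall i j : 'I_m, (i < j)%N -> lex_lt (t i) (t j)) ->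
  (forall i j, i != j -> incomp (t i) (t j)) -> i != j ->
  ptlt (cat_pt (t i) y) (cat_pt (t j) z) = (i < j)%N.
Proof.
move=> tlt tI ij; case: (ltngtP i j) => [lt_ij|lt_ji|/val_inj /eqP]; last by rewrite (negPf ij).
  by rewrite ptlt_incomp ?tI // tlt.
rewrite ptltNge ?ptlt_incomp ?tlt // 1?tI 1?eq_sym // => eq_ji.
have := incomp_inb (tI _ _ ij) (inb_cat (t i) y).
by rewrite -eq_ji inb_cat.
Qed.

(** * The sign as a homomorphism, and its agreement with table parity *)

Section Parity.
Variable H : {group {perm 'I_d}}.
Hypotheses (d_odd : odd d) (H_even : forall s, s \in H -> ~~ odd_perm s).

Definition uniformly_H (f : point d -> point d) n :=
  forall w, n <= size w -> exists v s, loc H f w v s.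

Lemma uniform_choice f n : uniformly_H f n ->
  exists (U : n.-tuple 'I_d -> word) (S : n.-tuple 'I_d -> {perm 'I_d}),
    forall w : n.-tuple 'I_d, loc H f w (U w) (S w).
Proof.
move=> fU; have /choice [F FP] : forall w : n.-tuple 'I_d,
    exists vs : word * {perm 'I_d}, loc H f w vs.1 vs.2.
  by move=> w; have [|v [s fw]] := fU w; rewrite ?size_tuple //; exists (v, s).
by exists (fst \o F), (snd \o F).
Qed.

Lemma tuple_cover n x : exists w : n.-tuple 'I_d, inb w x.
Proof. by exists [tuple of pre n x]; apply: inb_pre. Qed.

Lemma tuple_disjoint n (w w' : n.-tuple 'I_d) x : inb w x -> inb w' x -> w = w'.
Proof. by rewrite !inb_tuple => /eqP + /eqP ww; rewrite ww => /val_inj. Qed.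

(** The balls of the words of length [n] already form a partition with local forms, on which
    [sg_table] evaluates the sign at level [m]. *)
Lemma sg_stable f n m : uniformly_H f n -> n <= m -> sg m f = sg n f.
Proof.
move=> /uniform_choice [U [S US]] nm.
apply: (sg_table (v := fun w : n.-tuple 'I_d => tval w) (u := U) (h := S)) => //.
- by move=> w; apply: H_even; case: (US w).
- by move=> w y; case: (US w).
- exact: tuple_cover.
- exact: tuple_disjoint.
- by move=> w; apply: inb_cat.
- by move=> w; rewrite size_tuple.
Qed.

(** The order of the points [g (lp w)] serves as intermediate order. The second term counts
    inversions of [f] on the partition into images of balls under [g], which [sg_table] identifies
    with the sign of [f]. *)
Lemma sgM f g : locally_H H f -> locally_H H g ->
  exists n0, forall n, n0 <= n -> sg n (f * g) = sg n g (+) sg n f.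
Proof.
move=> /(locally_H_unif o) [nf fU] /(locally_H_unif o) [ng gU].
exists (ng + nf)%N => n le_n.
have x_inj : injective (fun w : n.-tuple 'I_d => lp w) := @lp_inj n.
have gx_inj : injective (fun w : n.-tuple 'I_d => g (lp w)).
  by move=> w w' /(@bij_inj _ g) /lp_inj.
have fgx_inj : injective (fun w : n.-tuple 'I_d => f (g (lp w))).
  by move=> w w' /(@bij_inj _ f) /(@bij_inj _ g) /lp_inj.
rewrite {1}/sg (invs_trans (pts_lt_tour x_inj) (pts_lt_tour gx_inj)) //; last first.
  exact: pts_lt_tour fgx_inj.
congr addb.
(* The first [ng] letters give a local form of [g]; the other letters, at least [nf] of them, make
   the image word long enough for a local form of [f]. *)
have gU' : forall w : n.-tuple 'I_d, exists vs : word * {perm 'I_d},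
    loc H g w vs.1 vs.2 /\ nf <= size vs.1.
  move=> w; have [|v [s gv]] := gU (take ng w).
    by rewrite size_takel // size_tuple; lia.
  exists (v ++ map s (drop ng w), s).
  split; first by rewrite -{1}[tval w](cat_take_drop ng); apply: loc_cat.
  by rewrite size_cat size_map size_drop size_tuple; lia.
have [VS VSP] := choice gU'; pose V (w : n.-tuple _) := (VS w).1.
have fU' : forall w : n.-tuple 'I_d, exists vs : word * {perm 'I_d},
    loc H f (V w) vs.1 vs.2.
  by move=> w; have [v [s fv]] := fU (V w) (VSP w).2; exists (v, s).
have [US USP] := choice fU'.
pose N := (n + \max_w size (V w))%N.
have <- : sg N f = sg n f.
  by rewrite (@sg_stable f nf n) ?(@sg_stable f nf) //; lia.
symmetry.
apply: (@sg_table f _ V (fun t => (US t).1) (fun t => (US t).2)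
  (fun t => g (lp t)) N) => //.
- by move=> w; apply: H_even; case: (USP w).
- by move=> w y; case: (USP w).
- move=> y; have [w wy] := tuple_cover n (g^-1 y); exists w.
  rewrite -[y](bijVK g); case/inbP: wy => z ->.
  by case: (VSP w) => -[_ ->] _; apply: inb_cat.
- move=> w w' y; case: (VSP w) => -[_ gw] _; case: (VSP w') => -[_ gw'] _.
  by move=> /(image_ball gw) yw /(image_ball gw'); apply: tuple_disjoint yw.
- by move=> w; case: (VSP w) => -[_ ->] _; apply: inb_cat.
- by move=> w; apply: leq_trans (leq_addl _ _); apply: leq_bigmax.
Qed.

Definition even_sg (f : point d -> point d) := exists n0, forall n, n0 <= n -> sg n f = false.

Lemma sg1 n : sg n (1 : bij (point d)) = false.
Proof.
apply: big1 => w _; apply: big1 => w' _; rewrite /pts_lt /=.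
have [->|ww] := eqVneq w w'; first by rewrite ptltxx.
by rewrite ptltNge ?andNb // => /lp_inj /eqP; rewrite eq_sym (negPf ww).
Qed.

Lemma even_sgM f g : locally_H H f -> locally_H H g ->
  even_sg f -> even_sg g -> even_sg (f * g).
Proof.
move=> fV gV [nf fE] [ng gE]; have [n0 fgE] := sgM fV gV.
exists (n0 + nf + ng)%N => n le_n; rewrite fgE ?fE ?gE //; lia.
Qed.

Lemma even_sgV f : locally_H H f -> even_sg f -> even_sg f^-1.
Proof.
move=> fV [nf fE]; have [n0 fgE] := sgM fV (locally_HV fV).
exists (n0 + nf)%N => n le_n.
have := fgE n; rewrite mulgV sg1 fE ?addbF; [move=> <- //|]; lia.
Qed.

(** By additivity the sign of the trivial cube is three times the sign of [t], that is, the sign of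
    [t]. *)
Lemma even_sg_cube (t : bij (point d)) : locally_H H t -> t * (t * t) = 1 -> even_sg t.
Proof.
move=> tV t3; have [n0 tt] := sgM tV tV; have [n1 ttt] := sgM tV (locally_HM tV tV).
exists (n0 + n1)%N => n le_n.
have := ttt n; rewrite t3 sg1 tt ?addbb ?addFb; [move=> <- //|]; lia.
Qed.

Lemma even_sg_twist v s : s \in H -> even_sg (twist v s).
Proof. by move=> Hs; exists (size v) => n vn; apply: sg_twist => //; apply: H_even. Qed.

(** As both lists of words are sorted, the inversions of [g] on the table are exactly those of
    [tau]. *)
Lemma table_even_sg g : has_even_table H g -> even_sg g.
Proof.
move=> [m [v [u [h [tau [[vlt [ult [[vcov vdisj] [[_ udisj] [Hh gv]]]]] tauE]]]]]].
have {}vdisj i j y : inb (v i) y -> inb (v j) y -> i = j.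
  by move=> /in_ballE vi /in_ballE; apply: vdisj vi.
have vI := disjoint_incomp vdisj.
have {}udisj i j y : inb (u i) y -> inb (u j) y -> i = j.
  by move=> /in_ballE ui /in_ballE; apply: udisj ui.
have uI := disjoint_incomp udisj.
exists (\max_i size (v i)) => n le_n.
rewrite (@sg_table g _ v (u \o tau) h (fun i => lp (v i))) //.
- rewrite -[RHS](negPf tauE) -invs_ord; apply: eq_invs => i j.
    have [->|ij] := eqVneq i j; first by rewrite /pts_lt ptltxx ltnn.
    exact: sorted_ptlt.
  have [->|ij] := eqVneq i j; first by rewrite /pts_lt ptltxx ltnn.
  by rewrite /pts_lt !gv (sorted_ptlt _ _ ult) // (inj_eq perm_inj).
- by move=> i; apply: H_even.
- by move=> y; have [i /in_ballE] := vcov y; exists i.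
- by move=> i; apply: inb_cat.
- by move=> i; apply: leq_trans le_n; apply: leq_bigmax.
Qed.

(** The words of a large length are enumerated once in their own order and once in the order of
    their images. The permutation relating the two enumerations has the parity of the sign. *)
Lemma even_sg_table g : locally_H H g -> even_sg g -> has_even_table H g.
Proof.
move=> /(locally_H_unif o) [n0 gU] [n1 gE]; pose n := (n0 + n1)%N.
have [U [S US]] : exists (U : n.-tuple 'I_d -> word) (S : n.-tuple 'I_d -> {perm 'I_d}),
    forall w : n.-tuple 'I_d, loc H g w (U w) (S w).
  by apply: uniform_choice => w le_n; apply: gU; lia.
have x_inj : injective (fun w : n.-tuple 'I_d => lp w) := @lp_inj n.
have gx_inj : injective (fun w : n.-tuple 'I_d => g (lp w)).
  by move=> w w' /(@bij_inj _ g) /lp_inj.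
have gw (w : n.-tuple 'I_d) y : g (cat_pt w y) = cat_pt (U w) (act (S w) y).
  by case: (US w).
have [r1 [k1 [r1K k1K lt1]]] := lt_enum x_inj.
have [r2 [k2 [r2K k2K lt2]]] := lt_enum gx_inj.
have Udisj (w w' : n.-tuple 'I_d) y : inb (U w) y -> inb (U w') y -> w = w'.
  move=> /(image_ball (gw w)) yw /(image_ball (gw w')).
  exact: tuple_disjoint yw.
have tau_inj : injective (k2 \o r1) := inj_comp (can_inj k2K) (can_inj r1K).
exists #|{: n.-tuple 'I_d}|, (fun i => tval (r1 i)), (U \o r2), (S \o r1), (perm tau_inj).
split; last first.
  rewrite -invs_ord; set b := invs _ _; suff -> : b = sg n g by rewrite gE ?leq_addl.
  have r1B : bijective r1 by exists k1.
  rewrite /b /sg -[RHS](invs_reindex _ _ r1B); apply: eq_invs => i j; first exact: lt1.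
  by rewrite !permE lt2 /= !k2K.
split=> [i j|].
  rewrite lt1; have [->|r1ij] := eqVneq (r1 i) (r1 j); first by rewrite ptltxx.
  by rewrite ptlt_incomp // tuple_incomp.
split=> [i j|].
  rewrite lt2; have [->|r2ij] := eqVneq (r2 i) (r2 j); first by rewrite ptltxx.
  by rewrite !gw ptlt_incomp // (disjoint_incomp Udisj).
split; first split=> [y|i j y /in_ballE yi /in_ballE yj].
- have [w wy] := tuple_cover n y; exists (k1 w); apply/in_ballE.
  by rewrite k1K.
- exact/(can_inj r1K)/(tuple_disjoint yi yj).
split; first split=> [y|i j y /in_ballE yi /in_ballE yj].
- have [w /inbP [z gy]] := tuple_cover n (g^-1 y); exists (k2 w); apply/in_ballE.
  by rewrite /= k2K -[y](bijVK g) gy gw inb_cat.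
- exact/(can_inj r2K)/(Udisj _ _ _ yi yj).
split=> [i|i y]; first by case: (US (r1 i)).
by rewrite gw permE /= k2K.
Qed.

End Parity.
End Sign.

(** * The hypotheses of Higman's argument for the group of even tables *)

Section Vprime.
Variables (d : nat) (H : {group {perm 'I_d}}) (a0 a1 : 'I_d).
Hypothesis a01 : a0 != a1.
Local Notation word := (seq 'I_d).
Implicit Types (u v w b c e p : word) (x y z : point d) (s : {perm 'I_d}).
Implicit Types (f g t : bij (point d)).

Definition Vp f := inVprime H f.

(** The existence of an even table becomes the vanishing of an additive invariant, from which
    closure under products follows. *)
Lemma VpE f : Vp f <-> locally_H H f /\
  (odd d /\ (forall s, s \in H -> ~~ odd_perm s) -> even_sg a0 f).
Proof.
rewrite /Vp /inVprime inVE; split=> -[fV fE]; split=> // -[dodd HE].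
  by apply: (table_even_sg a0 dodd HE); apply: fE.
by apply: (@even_sg_table _ a0) => //; apply: fE.
Qed.

Lemma Vp_grp : subgrp Vp.
Proof.
split.
- by apply/VpE; split=> [|_]; [exact: locally_H1 | exists 0 => n _; exact: sg1].
- move=> f g /VpE [fV fE] /VpE [gV gE]; apply/VpE.
  split=> [|dH]; first exact: locally_HM.
  by case: (dH) => dodd HE; apply: (even_sgM dodd HE) => //; [exact: fE | exact: gE].
move=> f /VpE [fV fE]; apply/VpE; split=> [|dH]; first exact: locally_HV.
by case: (dH) => dodd HE; apply: (even_sgV dodd HE) => //; exact: fE.
Qed.

Let VpM f g : Vp f -> Vp g -> Vp (f * g). Proof. by case: Vp_grp => _ + _; apply. Qed.
Let VpV f : Vp f -> Vp f^-1. Proof. by case: Vp_grp => _ _; apply. Qed.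

Lemma rot3_Vp t u v w : rot3 t u v w -> Vp t.
Proof.
move=> tr; have tV := rot3_locally_H H tr.
apply/VpE; split=> // -[dodd HE].
exact: (even_sg_cube a0 dodd HE tV (rot3_cube tr)).
Qed.

Lemma twist_Vp u s : s \in H -> Vp (twist u s).
Proof.
move=> Hs; apply/VpE; split=> [|[dodd HE]]; first exact: twist_locally_H.
exact: (even_sg_twist a0 HE).
Qed.

Lemma Vp_cont f x n : Vp f -> exists m, forall y, pre m y = pre m x -> pre n (f y) = pre n (f x).
Proof.
move=> /VpE [/locally_H_cont /(_ x n) [m fm] _]; exists m => y yx.
apply/eq_in_map => k; rewrite mem_iota add0n => /andP [_ kn].
symmetry; apply: fm kn => i im.
by move/eq_in_map: yx => /(_ i) ->; rewrite ?mem_iota.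
Qed.

Lemma Vp_ball_cont g c : Vp g -> exists c', forall x, inb c' x -> inb c (g x).
Proof.
move=> Vg; pose x0 := g^-1 (cat_pt c (fun=> a0)).
have [m gm] := Vp_cont x0 (size c) Vg.
exists (pre m x0) => x; rewrite /inb size_pre => /eqP /gm ->.
by rewrite bijVK pre_cat0.
Qed.

Lemma Vp_displace g x : Vp g -> g x <> x ->
  exists b, forall y, inb b y -> ~~ inb b (g y).
Proof.
move=> Vg gx; have [n [_ gxn]] := point_neq gx.
have [m gm] := Vp_cont x n.+1 Vg.
exists (pre (maxn m n.+1) x) => y; rewrite /inb size_pre => /eqP yx.
apply: contra gxn => /eqP gyx.
have le1 : m <= maxn m n.+1 by rewrite leq_maxl.
have le2 : n < maxn m n.+1 by rewrite leq_maxr.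
have /gm : pre m y = pre m x by rewrite !(pre_take _ le1) yx.
have : pre n.+1 (g y) = pre n.+1 x by rewrite !(pre_take _ le2) gyx.
by move=> -> /eq_in_map /(_ n); rewrite mem_iota ltnSn => ->.
Qed.

Lemma other_letter (a : 'I_d) : exists a', a' != a.
Proof. by have [<-|] := eqVneq a0 a; [exists a1; rewrite eq_sym | exists a0]. Qed.

(** The twist by [s] fixes the sibling ball [rcons u a1], and dividing [g] by it leaves an element
    fixing [rcons u a0]. *)
Lemma small_gen_twist (P : bij (point d) -> Prop) : subgrp P ->
  (forall f, small (@inb d) Vp f -> P f) ->
  forall g u s, Vp g -> s \in H ->
  (forall y, g (cat_pt (rcons u a0) y) = cat_pt (rcons u a0) (act s y)) -> P g.
Proof.
move=> [_ PM _] Psmall g u s Vg Hs gu.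
have uI : incomp (rcons u a1) (rcons u a0).
  by rewrite -!cats1 incomp_cat incomp_cons // eq_sym.
rewrite -(mulVKg (twist (rcons u a0) s) g); apply/PM; apply: Psmall; split.
- exact: twist_Vp.
- exists (rcons u a1) => x xu; apply: twistf_out.
  by rewrite (incomp_inb uI xu).
- by apply: VpM => //; apply/VpV/twist_Vp.
exists (rcons u a0) => _ /inbP [y ->].
by apply: (@bij_inj _ (twist (rcons u a0) s)); rewrite bijM bijVK gu [RHS]twistf_cat.
Qed.

(** A 3-cycle [t] sending [rcons u a0] to its image ball [rcons v (s a0)] fixes [rcons v (s a1)],
    and [t^-1 * g] maps [rcons u a0] to itself through [s]. *)
Lemma small_gen_incomp (P : bij (point d) -> Prop) : subgrp P ->
  (forall f, small (@inb d) Vp f -> P f) ->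
  forall g u v s, Vp g -> s \in H -> incomp u v ->
  (forall y, g (cat_pt u y) = cat_pt v (act s y)) -> P g.
Proof.
move=> Pg Psmall g u v s Vg Hs uv gu.
have [_ PM _] := Pg.
have sa : s a0 != s a1 by rewrite (inj_eq perm_inj).
have vr b c : incomp (u ++ b) (v ++ c) by apply/incomp_catl/incomp_catr.
have vl b c : incomp (v ++ b) (u ++ c) by rewrite incompC.
have [t tr] : exists t, rot3 t (rcons u a0) (rcons v (s a0)) (rcons u a1).
  apply: rot3_exists; rewrite -!cats1 ?vr ?vl //.
  by rewrite incomp_cat incomp_cons.
have Vt := rot3_Vp tr; case: tr => tu _ _ tout.
rewrite -(mulVKg t g); apply/PM.
  apply: Psmall; split=> //; exists (rcons v (s a1)) => x xv.
  apply: tout; apply/negbT; apply: incomp_inb xv; rewrite -!cats1 ?vl //.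
  by rewrite incomp_cat incomp_cons // eq_sym.
apply: (small_gen_twist Pg Psmall (u := u) (s := s)) => // [|y].
  by apply: VpM => //; apply: VpV.
apply: (@bij_inj _ t); rewrite bijM bijVK tu -cats1 cat_ptA gu act_cat /=.
by rewrite -cats1 cat_ptA.
Qed.

(** Reading at most one more letter makes the source and image words incomparable, except when
    [v = w] and [s] fixes [a0]; then [g] acts on the ball [rcons w a0] through [s]. *)
Lemma Vp_small_gen (P : bij (point d) -> Prop) : subgrp P ->
  (forall f, small (@inb d) Vp f -> P f) -> forall g, Vp g -> P g.
Proof.
move=> Pg Psmall g Vg; have [gV _] := (VpE g).1 Vg.
have [n [v [s gn]]] := gV (fun=> a0); move: gn; set w := pre _ _ => gn.
have via_incomp p : incomp (w ++ p) (v ++ map s p) -> P g.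
  move=> inc; have [Hs gwp] := loc_cat p gn.
  exact: small_gen_incomp Pg Psmall _ _ _ _ Vg Hs inc gwp.
have [/prefixP [[|b r] vE]|nwv] := boolP (prefix w v).
- rewrite cats0 in vE; have [sa|sa] := eqVneq (s a0) a0.
    have [Hs gwa] := loc_cat [:: a0] gn.
    apply: (small_gen_twist Pg Psmall (u := w) (s := s)) => // y.
    by rewrite -cats1 gwa vE /= sa.
  by apply: (via_incomp [:: a0]); rewrite vE incomp_cat incomp_cons // eq_sym.
- have [a ab] := other_letter b; apply: (via_incomp [:: a]).
  by rewrite vE -catA incomp_cat incomp_cons.
have [/prefixP [[|b r] wE]|nvw] := boolP (prefix v w).
- by rewrite wE cats0 prefix_refl in nwv.
- have [a ab] := other_letter b; apply: (via_incomp [:: s^-1 a]).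
  by rewrite wE -catA incomp_cat incomp_cons //= permKV eq_sym.
by apply: (via_incomp [::]); rewrite !cats0 /incomp nwv.
Qed.

(** With [b] the target word, the balls treated earlier go into [rcons b a0] and the next one into
    [b ++ [:: a1; a0]]; the induction therefore varies [e]. The ball of [b ++ [:: a1; a1]] only
    completes the 3-cycle. *)
Lemma gather (c : word) (ws : seq word) : (forall w, w \in ws -> incomp w c) ->
  forall e, exists2 t, Vp t &
    (forall x, ~~ inb (c ++ a0 :: e) x -> (forall w, w \in ws -> ~~ inb w x) -> t x = x) /\
    (forall w x, w \in ws -> inb w x -> inb (c ++ a0 :: e) (t x)).
Proof.
elim: ws => [_ e|w ws IH wsc e]; first by exists 1; first by case: Vp_grp.
have [w' w'ws|t Vt [tout tin]] := IH _ (rcons e a0).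
  by apply: wsc; rewrite inE w'ws orbT.
rewrite -rcons_cons -rcons_cat in tout tin; set b := c ++ a0 :: e in tout tin *.
have wc : incomp w c by apply: wsc; rewrite inE eqxx.
have wb p : incomp w (b ++ p) by rewrite /b -catA; apply: incomp_catr.
have bb p q : incomp (b ++ a0 :: p) (b ++ a1 :: q) by rewrite incomp_cat incomp_cons.
have [r rr] : exists r, rot3 r w (b ++ [:: a1; a0]) (b ++ [:: a1; a1]).
  by apply: rot3_exists => //; rewrite incomp_cat (incomp_cat _ _ [:: a1]) incomp_cons.
have Vr := rot3_Vp rr; case: rr => rw _ _ rout.
have r_fix x : inb (rcons b a0) x -> r x = x.
  rewrite -cats1 => xb; apply: rout; apply/negbT; apply: incomp_inb xb => //.
  by rewrite incompC.
have sub_b x : inb (rcons b a0) x -> inb b x by rewrite -cats1; apply: inb_catl.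
exists (r * t); first exact: VpM; split=> [x xb xws|w1 x w1in xw1]; rewrite bijM.
  have -> : t x = x.
    apply: tout => [|w' w'in]; first by apply: contra xb; apply: sub_b.
    by apply: xws; rewrite inE w'in orbT.
  apply: rout; first by apply: xws; rewrite inE eqxx.
    by apply: contra xb; apply: inb_catl.
  by apply: contra xb; apply: inb_catl.
have [/hasP [w' w'in xw']|/hasPn nws] := boolP (has (fun w' => inb w' x) ws).
  by rewrite r_fix ?sub_b // (tin w').
have {w1in} w1w : w1 = w.
  by move: w1in; rewrite inE => /predU1P [//|/nws]; rewrite xw1.
rewrite w1w in xw1; rewrite tout //.
  by case/inbP: xw1 => y ->; rewrite rw cat_ptA inb_cat.
by rewrite -cats1 (incomp_inb (wb _) xw1).
Qed.

(** The complement of the ball of [c] is the union of the balls of the other words of the same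
    length. *)
Lemma gather_compl c e : exists2 t, Vp t &
  (forall x, inb c x -> ~~ inb (c ++ a0 :: e) x -> t x = x) /\
  (forall x, ~~ inb c x -> inb (c ++ a0 :: e) (t x)).
Proof.
pose ws := [seq tval q | q <- enum {: (size c).-tuple 'I_d} & tval q != c].
have wsP w : (w \in ws) = (size w == size c) && (w != c).
  apply/mapP/andP => [[q + ->]|[sw wc]]; first by rewrite mem_filter size_tuple eqxx; case/andP.
  by exists (Tuple sw); rewrite // mem_filter wc mem_enum.
have wsI w : w \in ws -> incomp w c.
  by rewrite wsP => /andP [/eqP sw wc]; apply: incomp_size.
have [t Vt [tout tin]] := gather wsI e; exists t => //; split=> x xc.
  move=> xe; apply: tout => // w /wsI; rewrite incompC => cw.
  by rewrite (incomp_inb cw xc).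
apply: (tin (pre (size c) x)); last exact: inb_pre.
by rewrite wsP size_pre eqxx.
Qed.

Lemma Vp_push_small c e : exists t c1 e1,
  [/\ Vp t, forall x, inb c1 x -> inb c x, forall x, inb e1 x -> inb e x,
      fixes (@inb d) t c1 & forall x, inb e1 x -> inb c (t x)].
Proof.
(* The padding makes [b] longer than [e], so a letter [a] differing from that of [b] at index
   [size e] keeps the ball of [rcons e a] outside that of [b]. *)
have [t Vt [tfix tin]] := gather_compl c (nseq (size e) a0).
set b := c ++ _ in tfix tin.
have bc x : inb b x -> inb c x by apply: inb_catl.
have [a ab] := other_letter (nth a0 b (size e)).
exists t, (c ++ [:: a1]), (rcons e a); split=> //.
- by move=> x; apply: inb_catl.
- by move=> x; rewrite -cats1; apply: inb_catl.
- move=> x xc; apply: tfix; first exact: inb_catl xc.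
  have cI : incomp (c ++ [:: a1]) b by rewrite /b incomp_cat incomp_cons // eq_sym.
  by rewrite (incomp_inb cI xc).
move=> x xe; have xb : ~~ inb b x.
  apply: contra ab => xb.
  have /prefixP [q ->] : prefix (rcons e a) b.
    apply: inb_comparable xe xb _.
    by rewrite size_rcons size_cat /= size_nseq; lia.
  by rewrite nth_cat size_rcons ltnSn nth_rcons ltnn eqxx.
by case: (boolP (inb c x)) => xc; [rewrite tfix | apply/bc/tin].
Qed.

Lemma split_balls b c : exists p q, incomp (b ++ p) (c ++ q).
Proof.
have [/prefixP [r ->]|nbc] := boolP (prefix b c).
  by exists (r ++ [:: a0]), [:: a1]; rewrite -catA !incomp_cat incomp_cons.
have [/prefixP [r ->]|ncb] := boolP (prefix c b).
  by exists [:: a0], (r ++ [:: a1]); rewrite -catA !incomp_cat incomp_cons.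
by exists [::], [::]; rewrite !cats0 /incomp nbc.
Qed.

(** A 3-cycle first carries part of [b] onto the ball of [c1 ++ [:: a0]]. Points outside [b] then
    land outside that ball, and are gathered into it. *)
Lemma Vp_push b c : exists2 t, Vp t & forall x, ~~ inb b x -> inb c (t x).
Proof.
have [p [q bc]] := split_balls b c.
set b1 := b ++ p in bc; set c1 := c ++ q in bc.
have [r rr] : exists r, rot3 r b1 (c1 ++ [:: a0]) (c1 ++ [:: a1]).
  apply: rot3_exists; [exact: incomp_catr | | exact: incomp_catr].
  by rewrite incomp_cat incomp_cons.
have [t Vt [_ tin]] := gather_compl (c1 ++ [:: a0]) [::].
have Vr := rot3_Vp rr; case: rr => rb _ _ _.
exists (t * r) => [|x xb]; first exact: VpM.
rewrite bijM; suff /tin : ~~ inb (c1 ++ [:: a0]) (r x).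
  by rewrite -!catA; apply: inb_catl.
apply: contra xb => /inbP [y]; rewrite -rb => /(@bij_inj _ r) ->.
by rewrite cat_ptA inb_cat.
Qed.

Lemma Vp_rotate b : exists t b0,
  [/\ Vp t, forall x, inb b0 x -> [/\ inb b x, inb b (t x) & inb b (t^-1 x)] &
      forall x, inb b0 x -> [/\ ~~ inb b0 (t x), ~~ inb b0 (t^-1 x) & ~~ inb b0 (t (t x))]].
Proof.
have I12 : incomp [:: a0; a0] [:: a0; a1] by rewrite (incomp_cat _ _ [:: a0]) incomp_cons.
have I13 : incomp [:: a0; a0] [:: a1; a0] by rewrite incomp_cons.
have I23 : incomp [:: a0; a1] [:: a1; a0] by rewrite incomp_cons.
have [t rt] : exists t, rot3 t (b ++ [:: a0; a0]) (b ++ [:: a0; a1]) (b ++ [:: a1; a0]).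
  by apply: rot3_exists; rewrite incomp_cat.
have Vt := rot3_Vp rt; case: rt => t1 t2 t3 _.
exists t, (b ++ [:: a0; a0]).
have tV y : t^-1 (cat_pt (b ++ [:: a0; a0]) y) = cat_pt (b ++ [:: a1; a0]) y.
  by rewrite -t3 bijK.
split=> // _ /inbP [y ->]; rewrite tV ?t1 ?t2; split; rewrite ?cat_ptA ?inb_cat // -?cat_ptA.
- by apply/negbT; apply: incomp_inb (inb_cat _ _); rewrite incomp_cat incompC.
- by apply/negbT; apply: incomp_inb (inb_cat _ _); rewrite incomp_cat incompC.
by apply/negbT; apply: incomp_inb (inb_cat _ _); rewrite incomp_cat incompC.
Qed.

Definition Kp := commgen (fun f g => Vp f /\ Vp g).

Lemma Kp_nontrivial : exists2 f, Kp f & exists x, f x <> x.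
Proof.
have I12 : incomp [:: a0; a0] [:: a0; a1] by rewrite (incomp_cat _ _ [:: a0]) incomp_cons.
have [t tr] : exists t, rot3 t [:: a0; a0] [:: a0; a1] [:: a1; a0].
  by apply: rot3_exists; rewrite // incomp_cons.
have [r rr] : exists r, rot3 r [:: a0; a0] [:: a0; a1] [:: a1; a1].
  by apply: rot3_exists; rewrite // incomp_cons.
have [Vt Vr] := (rot3_Vp tr, rot3_Vp rr).
exists [~ t, r]; first exact: commgen_gen.
apply: contrapT => fixall.
have /eqP /commgP trC : [~ t, r] = 1.
  by apply: bij_ext => x; apply: contrapT => nx; apply: fixall; exists x.
(* On the ball of [[:: a0; a0]], [t * r] leads to [[:: a1; a0]] and [r * t] to [[:: a1; a1]]; the
   letters at index 1 differ. *)
have := congr1 (fun f : bij _ => f (cat_pt [:: a0; a0] (fun=> a0)) 1%N) trC.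
case: tr rr => t1 t2 _ _ [r1 r2 _ _].
by rewrite !bijM t1 r1 t2 r2 /= => /eqP; rewrite (negPf a01).
Qed.

Lemma comm_subgroupE (k : point d -> point d) :
  comm_subgroup (@inVprime d H) k <-> exists2 f, Kp f & bfun f = k.
Proof.
split=> [|[f Kf <-]].
  elim=> [|g h gi hi {}k Vg Vh gK giK hK hiK _ [f Kf <-]].
    by exists 1 => //; exact: commgen1.
  exists ([~ Bij gK giK, Bij hK hiK] * f) => //.
  exact: commgenM.
elim: Kf => [|g h {}f [Vg Vh] _ IH]; first exact: cs_one.
exact: (cs_mul Vg Vh (bijK g) (bijVK g) (bijK h) (bijVK h) IH).
Qed.

Lemma simple_comm_Vprime : simple_grp (comm_subgroup (@inVprime d H)).
Proof.
split.
  have [f Kf fx] := Kp_nontrivial; exists (bfun f); split=> //.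
  by apply/comm_subgroupE; exists f.
move=> N [[NK [N1 [NM NV]]] NJ].
have [Ntriv|] := pselect (forall n, N n -> forall x, n x = x); first by left.
move=> Nnt; right.
have [n Nn [x nx]] : exists2 n, N n & exists x, n x <> x.
  apply: contrapT => nex; apply: Nnt => n Nn x; apply: contrapT => nx.
  by apply: nex; exists n => //; exists x.
have /comm_subgroupE [f Kf fn] := NK _ Nn; rewrite -{n}fn in Nn nx.
move=> k /comm_subgroupE [g Kg <-].
apply: (@normal_full _ _ (@inb d) Vp Vp_grp Vp_ball_cont Vp_small_gen Vp_push_small
  Vp_push Vp_rotate _ (fun f : bij (point d) => N f) _ _ _ f x) => //.
- by move=> *; apply: Vp_displace; eassumption.
- split=> [|a b Na Nb|a Na]; [exact: N1 | exact: NM | ].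
  exact: (NV _ _ Na (bijK a) (bijVK a)).
- by move=> h /NK /comm_subgroupE [h' Kh' hh']; suff <- : h' = h by [];
    apply: bij_ext => y; rewrite hh'.
move=> h l Nh Kl; apply: (NJ l l^-1 h) => //; [|exact: bijK|exact: bijVK].
by apply/comm_subgroupE; exists l.
Qed.

End Vprime.

Theorem theorem8p16 (d : nat) (H : {group {perm 'I_d}}) :
  2 <= d -> simple_grp (comm_subgroup (@inVprime d H)).
Proof.
case: d H => [|[|d]] // H _.
by apply: (@simple_comm_Vprime _ H (Ordinal (ltn0Sn d.+1)) (Ordinal (isT : 1 < d.+2))).
Qed.
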